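(* Let the combinatorial classes $\mathcal{Q}_C,\mathcal{Q}_X,\mathcal{S}_C,\mathcal{S}_X,\mathcal{T}_Q,\mathcal{T}_S,\mathcal{T}_{Q-Q},\mathcal{T}_{Q\rightarrow Q},\mathcal{T}_{Q-S}$ be defined by \[ \mathcal{T}_Q=\mathcal{Q}_C\times\mathcal{Q}_C,\quad \mathcal{T}_S=\mathcal{Z}\times\mathcal{S}_C,\quad \mathcal{T}_{Q-Q}=\mathrm{Set}_{=2}(\mathcal{Q}_C),\quad \mathcal{T}_{Q\rightarrow Q}=\mathcal{Q}_C\times\mathcal{Q}_C,\quad \mathcal{T}_{Q-S}=\mathcal{Q}_X\times\mathcal{S}_X, \] \[ \mathcal{Q}_C=\mathrm{Set}_{=2}(\mathcal{Z}+\mathcal{S}_X),\quad \mathcal{Q}_X=\mathcal{Q}_C\times(\mathcal{Z}+\mathcal{S}_X),\quad \mathcal{S}_C=\mathrm{Set}_{\geq 2}(\mathcal{Q}_X),\quad \mathcal{S}_X=\mathcal{Z}\times\mathrm{Set}_{\geq 1}(\mathcal{Q}_X). \] Then the class $\mathcal{F}$ of (unrooted) 4-cactus graphs with at least three vertices satisfies $\mathcal{F}=\mathcal{T}_Q+\mathcal{T}_S+\mathcal{T}_{Q-Q}-\mathcal{T}_{Q\rightarrow Q}-\mathcal{T}_{Q-S}$, in the sense that for every $n$ the number of 4-cactus graphs on $n$ vertices equals the number of size-$n$ objects of $\mathcal{T}_Q$ plus that of $\mathcal{T}_S$ plus that of $\mathcal{T}_{Q-Q}$ minus that of $\mathcal{T}_{Q\rightarrow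 Q}$ minus that of $\mathcal{T}_{Q-S}$; this holds both for labeled graphs (labeled setting) and for unlabeled graphs (unlabeled setting).
   Context: A 4-cactus graph is a connected graph in which every edge lies on exactly one cycle, and that cycle has length 4. Combinatorial classes: $\mathcal{Z}$ consists of a single object of size 1 (an atom); $\mathcal{A}+\mathcal{B}$ is disjoint union, $\mathcal{A}\times\mathcal{B}$ is Cartesian product (sizes add); $\mathrm{Set}_{\geq k}(\mathcal{A})$ (resp. $\mathrm{Set}_{=k}(\mathcal{A})$) is the class of unordered collections of at least (resp. exactly) $k$ objects of $\mathcal{A}$, with size the total size. In the unlabeled setting these collections are multisets; in the labeled setting atoms carry distinct labels $1,\dots,n$, products are labeled products and sets are labeled sets. The system is understood to define the classes uniquely. *)

(* Defs.v *)
From HB Require Import structures.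
From mathcomp Require Import all_boot all_order all_fingroup all_algebra.
From mathcomp Require Import finmap multiset.

Set Implicit Arguments.
Unset Strict Implicit.
Unset Printing Implicit Defensive.

(* A simple graph with vertex set T is given by its set of edges, which are
   2-element subsets of T. *)
Definition simple_graph (T : finType) (G : {set {set T}}) : bool :=
  [forall e in G, #|e| == 2].

Definition adj (T : finType) (G : {set {set T}}) : rel T :=
  fun x y => [set x; y] \in G.

Definition connected_graph (T : finType) (G : {set {set T}}) : bool :=
  (0 < #|T|) && [forall x, forall y, connect (adj G) x y].

Definition cycle_edges (T : finType) (c : seq T) : {set {set T}} :=
  [set [set x; next c x] | x in c].

(* A cycle is a subgraph, hence it is identified with its set of edges: the
   rotations and reversals of a cyclic vertex sequence are the same cycle.
   The bound #|T| on the length k is no restriction, since the vertices of the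
   sequence are pairwise distinct. *)
Definition cycles (T : finType) (G : {set {set T}}) : {set {set {set T}}} :=
  [set C | [exists k : 'I_#|T|.+1, exists c : k.-tuple T,
              [&& 2 < k, ucycleb (adj G) c & C == cycle_edges c]]].

(* Every edge e lies on exactly one cycle C; the length of a cycle is its number
   of edges. *)
Definition four_cactus (T : finType) (G : {set {set T}}) : bool :=
  [&& simple_graph G, connected_graph G &
      [forall e in G, exists C : {set {set T}},
         ([set D in cycles G | e \in D] == [set C]) && (#|C| == 4)]].

Definition four_cacti (n : nat) : {set {set {set 'I_n}}} :=
  [set G : {set {set 'I_n}} | (3 <= n) && four_cactus G].

Definition graph_iso (T : finType) : rel {set {set T}} :=
  fun G H => [exists s : {perm T}, H == [set s @: (e : {set T}) | e : {set T} in G]].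

Definition num_labeled_four_cacti (n : nat) : nat := #|four_cacti n|.

Definition num_unlabeled_four_cacti (n : nat) : nat :=
  #|equivalence_partition (@graph_iso 'I_n) (four_cacti n)|.

(* A combinatorial class whose atoms carry elements of L; [atoms x] lists the
   atoms of the object x with multiplicity, in an irrelevant order.  The
   unlabeled setting is L = unit.  The labeled setting is L = nat, where the
   objects of size n that count are those in which the labels 1, ..., n all
   occur exactly once.  The components of such an object have pairwise disjoint
   label sets, so among these objects the Cartesian product below is the
   labeled product, and a multiset of nonempty objects is a labeled set. *)
Record cclass (L : Type) := CClass {
  obj :> choiceType;
  atoms : obj -> seq L }.

Definition catom (L : choiceType) : cclass L :=
  @CClass L L (fun l => [:: l]).

Definition csum (L : Type) (A B : cclass L) : cclass L :=
  @CClass L (A + B)%type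
    (fun x => match x with inl a => atoms a | inr b => atoms b end).

Definition cprod (L : Type) (A B : cclass L) : cclass L :=
  @CClass L (A * B)%type (fun x => atoms x.1 ++ atoms x.2).

Definition cset (L : Type) (P : pred nat) (A : cclass L) : cclass L :=
  @CClass L {M : {mset A}%mset | P (size M)}
    (fun M => flatten [seq atoms a | a <- enum_mset (val M)]).

Definition cset_geq (L : Type) (k : nat) (A : cclass L) : cclass L :=
  cset (fun m => k <= m) A.

Definition cset_eq (L : Type) (k : nat) (A : cclass L) : cclass L :=
  cset (fun m => m == k) A.

(* Equality of classes in a specification is isomorphism. *)
Definition ciso (L : choiceType) (A B : cclass L) : Prop :=
  exists2 f : A -> B, bijective f & forall a, perm_eq (atoms (f a)) (atoms a).

Record cactus_spec (L : choiceType) := CactusSpec {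
  Q_C : cclass L;
  Q_X : cclass L;
  S_C : cclass L;
  S_X : cclass L;
  T_Q : cclass L;
  T_S : cclass L;
  T_QQ : cclass L;
  T_QtoQ : cclass L;
  T_QS : cclass L;
  T_Q_def : ciso T_Q (cprod Q_C Q_C);
  T_S_def : ciso T_S (cprod (catom L) S_C);
  T_QQ_def : ciso T_QQ (cset_eq 2 Q_C);
  T_QtoQ_def : ciso T_QtoQ (cprod Q_C Q_C);
  T_QS_def : ciso T_QS (cprod Q_X S_X);
  Q_C_def : ciso Q_C (cset_eq 2 (csum (catom L) S_X));
  Q_X_def : ciso Q_X (cprod Q_C (csum (catom L) S_X));
  S_C_def : ciso S_C (cset_geq 2 Q_X);
  S_X_def : ciso S_X (cprod (catom L) (cset_geq 1 Q_X)) }.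

Definition has_card (T : choiceType) (P : pred T) (k : nat) : Prop :=
  exists2 s : {fset T}%fset, (forall x, (x \in s) = P x) & #|` s|%fset = k.

Definition labeled_count (A : cclass nat) (n k : nat) : Prop :=
  has_card (fun a : A => perm_eq (atoms a) (iota 1 n)) k.

Definition unlabeled_count (A : cclass unit) (n k : nat) : Prop :=
  has_card (fun a : A => size (atoms a) == n) k.

(* The system has a solution, so quantifying over [cactus_spec L] is not vacuous. *)
Module Existence.

Lemma bij_inj_surj (A B : choiceType) (f : A -> B) :
  injective f -> (forall b, exists a, f a = b) -> bijective f.
Proof.
move=> fI fS.
have fS' b : exists a, f a == b by have [a <-] := fS b; exists a.
exists (fun b => xchoose (fS' b)) => [a|b]; last exact/eqP/(xchooseP (fS' b)).
by apply/fI/eqP/(xchooseP (fS' (f a))).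
Qed.

Section Iso.
Variable L : choiceType.
Implicit Types A B C : cclass L.

Lemma ciso_refl A : ciso A A.
Proof. by exists id => //; exists id. Qed.

Lemma ciso_sym A B : ciso A B -> ciso B A.
Proof.
case=> f [g fK gK] fa; exists g; first by exists f.
by move=> b; rewrite -{2}(gK b) perm_sym fa.
Qed.

Lemma ciso_trans A B C : ciso A B -> ciso B C -> ciso A C.
Proof.
case=> f fb fa [g gb ga]; exists (g \o f); first exact: bij_comp.
by move=> a; apply: perm_trans (ga _) (fa _).
Qed.

Lemma ciso_prod A A' B B' : ciso A A' -> ciso B B' -> ciso (cprod A B) (cprod A' B').
Proof.
case=> f [f' fK fK'] fa [g [g' gK gK'] ga].
exists (fun x : A * B => (f x.1, g x.2)); last by move=> x; apply: perm_cat; [apply: fa|apply: ga].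
exists (fun x => (f' x.1, g' x.2)) => -[x y] /=; first by rewrite fK gK.
by rewrite fK' gK'.
Qed.

Lemma size_canon (T : choiceType) (s : seq T) : size (seq_mset s) = size s.
Proof. exact/perm_size/perm_eq_seq_mset. Qed.

Lemma perm_flatten_map (T : eqType) (S : choiceType) (f g : T -> seq S) (s : seq T) :
  (forall x, perm_eq (f x) (g x)) ->
  perm_eq (flatten (map f s)) (flatten (map g s)).
Proof. by move=> fg; elim: s => //= x s IH; apply: perm_cat. Qed.

Lemma perm_flatten_map2 (T : eqType) (S : choiceType) (f : T -> seq S) (s t : seq T) :
  perm_eq s t -> perm_eq (flatten (map f s)) (flatten (map f t)).
Proof. by move=> st; apply: perm_flatten; apply: perm_map. Qed.

Lemma ciso_set P A B : ciso A B -> ciso (cset P A) (cset P B).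
Proof.
case=> f fb fa; have [f' fK f'K] := fb.
have pf (M : cset P A) : P (size (seq_mset (map f (enum_mset (val M))))).
  by rewrite size_canon size_map (valP M).
exists (fun M : cset P A => exist _ (seq_mset (map f (enum_mset (val M)))) (pf M)
          : cset P B).
  apply: bij_inj_surj => [M N /(congr1 val)/= /eq_seq_msetP|N].
    move/(perm_map f'); rewrite -!map_comp !(eq_map fK) !map_id => /eq_seq_msetP.
    by rewrite !seq_mset_id => /val_inj.
  have pN : P (size (seq_mset (map f' (enum_mset (val N))))).
    by rewrite size_canon size_map (valP N).
  exists (exist (fun M : {mset A}%mset => P (size M)) (seq_mset (map f' (enum_mset (val N)))) pN); apply/val_inj => /=; rewrite -[RHS]seq_mset_id.
  apply/eq_seq_msetP; apply: perm_trans (perm_map f (perm_eq_seq_mset _)) _.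
  by rewrite -map_comp (eq_map f'K) map_id.
move=> M /=; apply: perm_trans (perm_flatten_map2 _ (perm_eq_seq_mset _)) _.
by rewrite -map_comp; apply: perm_flatten_map.
Qed.

Definition canon (T : choiceType) (s : seq T) := s == seq_mset s :> seq T.

Let U : choiceType := GenTree.tree L.
Fixpoint leaves (t : GenTree.tree L) : seq L := match t with
  | GenTree.Leaf l => [:: l] | GenTree.Node _ ts => flatten (map leaves ts) end.

Definition is_leaf (t : GenTree.tree L) := if t is GenTree.Leaf _ then true else false.
Fixpoint okX (t : GenTree.tree L) : bool := match t with
  | GenTree.Node 0 (GenTree.Leaf l :: qs) =>
    [&& 0 < size qs, canon (qs : seq U) & all (fun q => match q with
        | GenTree.Node 1 (y :: ab) =>
            [&& is_leaf y || okX y, size ab == 2, canon (ab : seq U)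
              & all (fun a => is_leaf a || okX a) ab]
        | _ => false end) qs]
  | _ => false end.
Definition okE (t : U) := is_leaf t || okX t.
Definition okQ (q : U) := match q with
        | GenTree.Node 1 (y :: ab) =>
            [&& okE y, size ab == 2, canon (ab : seq U) & all okE ab]
        | _ => false end.
Definition sub (P : pred U) : cclass L := @CClass L {t : U | P t} (fun t => leaves (val t)).

Lemma perm_seq_msetE (T : choiceType) (s t : seq T) :
  (seq_mset s : seq T) = seq_mset t -> perm_eq s t.
Proof.
move=> e; apply: perm_trans (perm_eq_seq_mset t).
by rewrite -e perm_sym perm_eq_seq_mset.
Qed.

Lemma ciso_node (k : nat) (A : cclass L) (eA : A -> U) (R : pred nat) (p r : pred U)
  (eI : injective eA) (eL : forall a, perm_eq (leaves (eA a)) (atoms a))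
  (rP : forall t, r t <-> exists a qs, [/\ t = GenTree.Node k (eA a :: qs),
                 R (size qs), canon (qs : seq U) & all p qs]) :
  ciso (cprod A (cset R (sub p))) (sub r).
Proof.
pose F (x : cprod A (cset R (sub p))) : U :=
  GenTree.Node k (eA x.1 :: seq_mset (map val (enum_mset (val x.2)))).
have rF x : r (F x).
  apply/rP; exists x.1, (seq_mset (map val (enum_mset (val x.2)))); split=> //.
  - by rewrite size_canon size_map (valP x.2).
  - by rewrite /canon seq_mset_id.
  rewrite (perm_all _ (perm_eq_seq_mset _)).
  by apply/allP => _ /mapP[t _ ->]; exact: (valP t).
exists (fun x => exist _ (F x) (rF x) : sub r).
  apply: bij_inj_surj => [[a M] [b N]|[t tr]].
    move/(congr1 val) => -[] /eI -> /= /perm_seq_msetE.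
    move/(perm_map_inj val_inj)/eq_seq_msetP.
    by rewrite !seq_mset_id => /val_inj ->.
  have /rP [a [qs [et Rq cq pq]]] := tr.
  pose qs' : seq (sub p) := pmap insub qs.
  have eqs : map val qs' = qs.
    rewrite /qs' (pmap_filter (@insubK _ _ _)).
    by apply/all_filterP; apply: sub_all pq => u pu; rewrite isSome_insub.
  have Rq' : R (size (seq_mset qs' : {mset sub p}%mset)) by rewrite size_canon -(size_map val) eqs.
  exists (a, exist (fun M : {mset sub p}%mset => R (size M)) (seq_mset qs') Rq'); apply/val_inj; rewrite /= et /F /=.
  congr (GenTree.Node _ (_ :: _)).
  rewrite [RHS](eqP cq); congr enum_mset; apply/eq_seq_msetP.
  by rewrite -[X in perm_eq _ X]eqs; apply: perm_map; apply: perm_eq_seq_mset.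
move=> x /=; apply: perm_cat => //.
apply: perm_trans (perm_flatten_map2 _ (perm_eq_seq_mset _)) _.
by rewrite -map_comp.
Qed.

Lemma isoE : ciso (csum (catom L) (sub okX)) (sub okE).
Proof.
have kL l : okE (GenTree.Leaf l) by [].
have kX (t : sub okX) : okE (val t) by rewrite /okE (valP t) orbT.
exists (fun x : csum (catom L) (sub okX) => match x with inl l => exist (fun t : U => okE t) (GenTree.Leaf l) (kL l)
         | inr t => exist (fun t : U => okE t) (val t) (kX t) end : sub okE); last by case.
apply: bij_inj_surj => [[l|t] [l'|t'] /(congr1 val) /= |].
- by case=> ->.
- by case: t' => t' /= + e; rewrite -e.
- by case: t => t /= + e; rewrite e.
- by move/val_inj ->.
case=> t tE; have := tE; case/orP => [|tX].
  by case: t tE => // l lE _; exists (inl l); apply/val_inj.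
by exists (inr (exist (fun t : U => okX t) t tX)); apply/val_inj.
Qed.

Lemma isoQ : ciso (cprod (sub okE) (cset_eq 2 (sub okE))) (sub okQ).
Proof.
apply: (@ciso_node 1 (sub okE) val) => //; first exact: val_inj.
move=> t; split=> [|[y [qs [-> /= s2 cq aq]]]]; last by rewrite (valP y) s2 cq.
case: t => // -[|[|//]] [|y ab] //= /and4P[yE s2 cq aq].
by exists (exist (fun t : U => okE t) y yE), ab; split.
Qed.

Lemma isoX : ciso (cprod (catom L) (cset_geq 1 (sub okQ))) (sub okX).
Proof.
apply: (@ciso_node 0 (catom L) (fun l => GenTree.Leaf l)) => //; first by move=> ? ? [].
move=> t; split=> [|[y [qs [-> /= s2 cq aq]]]]; last by apply/and3P; split.
case: t => // -[|//] [|[l|//] qs] //= /and3P[s1 cq aq].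
by exists l, qs; split.
Qed.

Lemma ciso_prodC A B : ciso (cprod A B) (cprod B A).
Proof.
exists (fun x : A * B => (x.2, x.1)); last by move=> x; rewrite /= perm_catC.
by exists (fun x : B * A => (x.2, x.1)) => -[].
Qed.

(* S_X is realized by trees in which every multiset is listed in its canonical
   order. *)
Theorem cactus_spec_inhabited : inhabited (cactus_spec L).
Proof.
pose X := sub okX; pose E := csum (catom L) X.
pose QC := cset_eq 2 E; pose QX := cprod QC E.
apply: inhabits; apply: (@CactusSpec L QC QX (cset_geq 2 QX) X);
  try exact: ciso_refl.
apply/ciso_sym; apply: ciso_trans isoX; apply: ciso_prod (ciso_refl _) _.
apply: ciso_set; apply: ciso_trans isoQ; apply: ciso_trans (ciso_prodC _ _) _.
by apply: ciso_prod isoE _; apply: ciso_set isoE.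
Qed.
End Iso.

End Existence.

(* Main.v *)
Require Import Defs.
From mathcomp Require Import all_boot all_order all_fingroup all_algebra.
From mathcomp Require Import finmap multiset zify.
Import Defs.

(* Every vertex of a 4-cactus is either an atom or a cut vertex, so with
   E = Z + S_X the classes S_X, Q_X * E and T_{Q-Q} count the cacti pointed at a
   vertex, at a flag (a vertex on a cycle) and at a cycle.  Since
   S_X = Z * Q_X + T_S, Q_X * E = Q_X * Z + T_{Q-S} and T_Q = T_{Q->Q}, the claim is
   #cacti = #S_X + #T_{Q-Q} - #(Q_X * E).

   Both settings are treated at once: given a colouring of the vertices by L, the
   objects over L with the right atoms are the orbits of graphs on the vertices
   under the colour-preserving permutations.  The colouring is injective in the
   labeled setting and constant in the unlabeled one.

   The dissymmetry is obtained from linear algebra.  The incidence graph between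
   vertices and cycles is connected and has as many vertices as edges plus one, so
   its incidence matrix completed by a row of ones is square and invertible.  It
   commutes with every automorphism, hence the numbers of fixed vertices and cycles
   and of fixed flags and graphs agree, and Burnside's lemma concludes. *)

Set Implicit Arguments.
Unset Strict Implicit.
Unset Printing Implicit Defensive.

(** * Trees of 4-cycles *)

(** Neither side of the count has an induction of its own: a graph is a bare set of edges, and a
    solution of the system is known only through isomorphisms. Trees modulo [teq] mediate. With
    distinct vertices as labels they stand for rooted graphs, with labels in L for elements of E.
    Four trees around a 4-cycle, a [quad], present a vertex, a flag or a cycle, depending on which
    of three equivalences is taken. These equivalences rearrange subtrees without reading labels, so
    they lift along any colouring; this is what turns equality of coloured objects into lying in one
    orbit of colour-preserving permutations. A bijective proof of the dissymmetry would have to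
    choose a centre in every cactus compatibly with its automorphisms; an invertible matrix that
    commutes with them requires no choice. It is square because a cactus with c cycles has 3c + 1
    vertices and 4c flags. *)

Lemma eq_cat_size (T : Type) (s1 s2 r1 r2 : seq T) :
  size s1 = size r1 -> s1 ++ s2 = r1 ++ r2 -> s1 = r1 /\ s2 = r2.
Proof. by elim: s1 r1 => [[]|x s IH [//|y r] /= [/IH e] [-> /e[-> ->]]]. Qed.

(* [Nd t a b d] adds to [t] a cycle through the roots of [t], [a], [d], [b], in this
   cyclic order; the cycles at a vertex are thus listed along the first argument,
   in an order that [teq] forgets. *)
Inductive tree (L : Type) := Lf (l : L) | Nd (t a b d : tree L).

Fixpoint root L (t : tree L) : L :=
  match t with Lf l => l | Nd t _ _ _ => root t end.

Fixpoint labels L (t : tree L) : seq L :=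
  match t with
  | Lf l => [:: l]
  | Nd t a b d => labels t ++ labels a ++ labels b ++ labels d
  end.

Fixpoint tmap L L' (f : L -> L') (t : tree L) : tree L' :=
  match t with
  | Lf l => Lf (f l)
  | Nd t a b d => Nd (tmap f t) (tmap f a) (tmap f b) (tmap f d)
  end.

(** [teq_swap] reflects a cycle in the axis through the root; [teq_comm] exchanges the last two
    cycles at the root. Both are their own inverses, so symmetry needs no constructor. *)
Inductive teq L : tree L -> tree L -> Prop :=
| teq_refl t : teq t t
| teq_trans t u v : teq t u -> teq u v -> teq t v
| teq_swap t a b d : teq (Nd t a b d) (Nd t b a d)
| teq_comm t a b d a' b' d' :
    teq (Nd (Nd t a b d) a' b' d') (Nd (Nd t a' b' d') a b d)
| teq_cong t a b d t' a' b' d' : teq t t' -> teq a a' -> teq b b' -> teq d d' ->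
    teq (Nd t a b d) (Nd t' a' b' d').
#[local] Hint Resolve teq_refl : core.

Section TreeTheory.
Variables L L' : Type.
Implicit Types t a b d : tree L.

Lemma teq_sym t u : teq t u -> teq u t.
Proof.
elim=> {t u} //.
- by move=> t u v _ IH1 _ IH2; apply: teq_trans IH2 IH1.
- by move=> *; apply: teq_swap.
- by move=> *; apply: teq_comm.
- by move=> *; apply: teq_cong.
Qed.

Lemma root_teq t u : teq t u -> root t = root u.
Proof. by elim=> {t u} // t u v _ -> _ ->. Qed.

Lemma labels_root t : labels t = root t :: behead (labels t).
Proof. by elim: t => //= t -> *. Qed.

Lemma size_labels_gt0 t : 0 < size (labels t).
Proof. by rewrite labels_root. Qed.

Lemma labels_tmap (f : L -> L') t : labels (tmap f t) = map f (labels t).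
Proof. by elim: t => //= t -> a -> b -> d ->; rewrite !map_cat. Qed.

Lemma root_tmap (f : L -> L') t : root (tmap f t) = f (root t).
Proof. by elim: t. Qed.

(** The generators of [teq] move whole subtrees and never read a label, so each can be replayed on
    the tree before relabelling. *)
Lemma teq_lift (f : L -> L') t u :
  teq (tmap f t) u -> exists2 t', teq t t' & tmap f t' = u.
Proof.
move=> tu; move e: (tmap f t) tu => v vu; elim: vu t e => {u v}.
- by move=> u t <-; exists t.
- move=> u1 u2 u3 _ IH1 _ IH2 t /IH1[t1 tt1 /IH2[t2 t12 <-]].
  by exists t2 => //; apply: teq_trans t12.
- move=> u a b d [//|t a' b' d'] /= [<- <- <- <-].
  by exists (Nd t b' a' d') => //; apply: teq_swap.
- move=> u a b d a' b' d' [//|[//|t a1 b1 d1] a2 b2 d2] /= [<- <- <- <- <- <- <-].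
  by exists (Nd (Nd t a2 b2 d2) a1 b1 d1) => //; apply: teq_comm.
- move=> u a b d u' a' b' d' _ IHu _ IHa _ IHb _ IHd [//|t1 a1 b1 d1] /=.
  case=> /IHu[t2 ? <-] /IHa[a2 ? <-] /IHb[b2 ? <-] /IHd[d2 ? <-].
  by exists (Nd t2 a2 b2 d2) => //; apply: teq_cong.
Qed.

(** The shape of [u] prescribes how many labels each subtree takes, and [s] is cut at these lengths.
    This produces a vertex-labelled tree above a coloured one. *)
Lemma tmap_fill (f : L -> L') (u : tree L') (s : seq L) :
  map f s = labels u -> exists2 t, labels t = s & tmap f t = u.
Proof.
elim: u s => [l [|x []]//= [<-]|u IHu a IHa b IHb d IHd s /= e]; first by exists (Lf x).
have split3 (s1 : seq L) (r1 r2 : seq L') : map f s1 = r1 ++ r2 ->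
    exists p1 p2, [/\ s1 = p1 ++ p2, map f p1 = r1 & map f p2 = r2].
  move=> e1; exists (take (size r1) s1), (drop (size r1) s1).
  by rewrite cat_take_drop map_take map_drop e1 take_size_cat // drop_size_cat.
have [s1 [s2 [-> /IHu[t <- <-]]]] := split3 _ _ _ e.
move/split3=> [s3 [s4 [-> /IHa[a' <- <-]]]].
move/split3=> [s5 [s6 [-> /IHb[b' <- <-]]]] /IHd[d' <- <-].
by exists (Nd t a' b' d').
Qed.

Lemma size_labels_tmap (f : L -> L') t : size (labels (tmap f t)) = size (labels t).
Proof. by rewrite labels_tmap size_map. Qed.

(** [tmap f] keeps the shape, and a shape with its list of labels determines the tree. *)
Lemma tmap_labels_inj (f : L -> L') t t' :
  tmap f t = tmap f t' -> labels t = labels t' -> t = t'.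
Proof.
elim: t t' => [l [l' _ [->]//|//]|t IHt a IHa b IHb d IHd [//|t' a' b' d'] /=].
case=> et ea eb ed; have sz x y : tmap f x = tmap f y -> size (labels x) = size (labels y).
  by move=> e; rewrite -(size_labels_tmap f x) e size_labels_tmap.
case/(eq_cat_size (sz _ _ et))=> /(IHt _ et)-> /(eq_cat_size (sz _ _ ea))[/(IHa _ ea)->].
by case/(eq_cat_size (sz _ _ eb))=> /(IHb _ eb)-> /(IHd _ ed)->.
Qed.

Lemma eq_in_tmap (L1 : eqType) (f g : L1 -> L') (t : tree L1) :
  {in labels t, f =1 g} -> tmap f t = tmap g t.
Proof.
elim: t => [l /= -> //|t IHt a IHa b IHb d IHd /= e]; first by rewrite inE.
by rewrite IHt ?IHa ?IHb ?IHd // => x xt; apply: e; rewrite !mem_cat xt ?orbT.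
Qed.

End TreeTheory.

Lemma tmap_comp (L1 L2 L3 : Type) (f : L2 -> L3) (g : L1 -> L2) (t : tree L1) :
  tmap f (tmap g t) = tmap (f \o g) t.
Proof. by elim: t => //= t -> a -> b -> d ->. Qed.

Lemma perm_labels (L : eqType) (t u : tree L) : teq t u -> perm_eq (labels t) (labels u).
Proof.
elim=> {t u} //=.
- by move=> t u v _ tu _; apply: perm_trans tu.
- by move=> t a b d; rewrite perm_cat2l perm_catCA.
- by move=> t a b d a' b' d'; apply/seq.permP => x; rewrite !count_cat; lia.
- by move=> *; rewrite !perm_cat.
Qed.

(** * Cycles in a union of graphs *)

Lemma eq_set2 (T : finType) (x y z w : T) :
  [set x; y] = [set z; w] -> (x = z /\ y = w) \/ (x = w /\ y = z).
Proof.
move=> e; have : x \in [set z; w] by rewrite -e set21.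
have : y \in [set z; w] by rewrite -e set22.
have : z \in [set x; y] by rewrite e set21.
have : w \in [set x; y] by rewrite e set22.
rewrite !inE.
by case/orP=> /eqP ew; case/orP=> /eqP ez; case/orP=> /eqP ey; case/orP=> /eqP ex; subst; auto.
Qed.

Section Cycles.
Variable T : finType.
Implicit Types (G H C D : {set {set T}}) (c p : seq T) (x y z : T) (e : {set T}).

Lemma adjC G : symmetric (adj G).
Proof. by move=> x y; rewrite /adj setUC. Qed.

Lemma connectC G : connect_sym (adj G).
Proof. exact/sym_connect_sym/adjC. Qed.

Lemma adj_sub G H : G \subset H -> subrel (adj G) (adj H).
Proof. by move=> GH x y; apply: (subsetP GH). Qed.

Lemma cyclesP G C :
  reflect (exists c, [/\ 2 < size c, ucycle (adj G) c & C = cycle_edges c])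
          (C \in cycles G).
Proof.
rewrite inE; apply: (iffP existsP) => [[k /existsP[c /and3P[k2 cc /eqP->]]]|[c [c2 cc ->]]].
  by exists c; rewrite size_tuple.
have sc : size c < #|T|.+1.
  by case/andP: cc => _ /card_uniqP <-; rewrite ltnS max_card.
by exists (Ordinal sc); apply/existsP; exists (in_tuple c); apply/and3P; split.
Qed.

Lemma cycle_edges_sub G c : path.cycle (adj G) c -> cycle_edges c \subset G.
Proof. by move=> cc; apply/subsetP => e /imsetP[x xc ->]; apply: next_cycle cc xc. Qed.

Lemma cycles_sub G C : C \in cycles G -> C \subset G.
Proof. by case/cyclesP=> c [_ /andP[cc _] ->]; apply: cycle_edges_sub. Qed.

Lemma ucycle_edges c : uniq c -> path.cycle (adj (cycle_edges c)) c.
Proof. by move=> uc; apply: cycle_from_next => // x xc; apply: imset_f. Qed.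

Lemma cycles_subr G H C : C \in cycles G -> C \subset H -> C \in cycles H.
Proof.
case/cyclesP=> c [c2 /andP[cc uc] ->] cH; apply/cyclesP; exists c; split=> //.
by apply/andP; split=> //; apply: sub_cycle (ucycle_edges uc); apply: adj_sub.
Qed.

Lemma cycles_mono G H C : G \subset H -> C \in cycles G -> C \in cycles H.
Proof. by move=> GH CG; apply: cycles_subr (CG) (subset_trans (cycles_sub CG) GH). Qed.

Lemma cycle_edges_rot k c : uniq c -> cycle_edges (rot k c) = cycle_edges c.
Proof.
move=> uc; rewrite /cycle_edges; apply/setP => e; apply/imsetP/imsetP => -[x xc ->];
  exists x; rewrite ?next_rot // ?mem_rot // in xc *.
Qed.

Lemma prev_head x p : x \notin p -> prev (x :: p) x = last x p.
Proof. by move=> xp; rewrite prev_nth mem_head memNindex // -last_nth. Qed.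

Lemma next_prev_neq c x : uniq c -> 2 < size c -> x \in c -> next c x != prev c x.
Proof.
move=> uc c2 xc; have [k s ec] := rot_to xc.
have uxs : uniq (x :: s) by rewrite -ec rot_uniq.
rewrite -(next_rot k uc) -(prev_rot k uc) ec.
have : 2 < size (x :: s) by rewrite -ec size_rot.
case: s uxs {ec} => [//|y [//|z s]] uxs _.
case/and4P: uxs => xs yzs _ _.
have -> : next (x :: y :: z :: s) x = y by rewrite /= eqxx.
have -> : prev (x :: y :: z :: s) x = last z s by rewrite prev_head.
by apply: contraNneq yzs => ->; rewrite mem_last.
Qed.

(** If two positions shared an edge, the successor of [x] would also be its predecessor. *)
Lemma cycle_edges_inj c : uniq c -> 2 < size c ->
  {in c &, injective (fun x => [set x; next c x])}.
Proof.
move=> uc c2 x y xc yc /eq_set2[[]//|[exy ey]].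
have := next_prev_neq uc c2 xc; rewrite ey.
by rewrite exy prev_next // eqxx.
Qed.

Lemma card_cycle_edges c : uniq c -> 2 < size c -> #|cycle_edges c| = size c.
Proof.
move=> uc c2; rewrite card_in_imset; last exact: cycle_edges_inj.
by have /card_uniqP <- := uc; apply: eq_card.
Qed.

Lemma cover_cycle_edges c : cover (cycle_edges c) = [set x in c].
Proof.
apply/setP => x; rewrite inE; apply/bigcupP/idP => [[_ /imsetP[y yc ->]]|xc].
  by rewrite !inE => /orP[]/eqP-> //; rewrite mem_next.
exists [set x; next c x]; [exact: (imset_f (fun y => [set y; next c y]))|exact: set21].
Qed.

Lemma adj_cover G x y : adj G x y -> x \in cover G.
Proof. by move=> xy; apply/bigcupP; exists [set x; y]; rewrite ?set21. Qed.

(** A path can change sides only at [r], which occurs here at most as the endpoint [z]. *)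
Lemma path_glue G H r x p z : (forall z, z \in cover G -> z \in cover H -> z = r) ->
  r \notin x :: p -> x \in cover G ->
  path (adj (G :|: H)) x (rcons p z) -> path (adj G) x (rcons p z).
Proof.
move=> GHr; have step u v : u != r -> u \in cover G -> adj (G :|: H) u v -> adj G u v.
  move=> ur uG; rewrite /adj inE => /orP[//|/adj_cover/(GHr _ uG) e].
  by rewrite e eqxx in ur.
elim: p x => [x|y p IH x] /=; rewrite in_cons negb_or eq_sym => /andP[xr rp] xG /andP[xy yp].
  by rewrite step.
have Gxy := step _ _ xr xG xy; rewrite Gxy /= IH //.
by apply: (@adj_cover G y x); rewrite adjC.
Qed.

(** After a rotation that puts [r] first if it is visited, the cycle meets [r] nowhere else; the
    side of its first edge is then never left. *)
Lemma cycles_glue G H r C : (forall z, z \in cover G -> z \in cover H -> z = r) ->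
  C \in cycles (G :|: H) -> C \in cycles G \/ C \in cycles H.
Proof.
move=> GHr /cyclesP[c [c2 /andP[cc uc] ->]].
have [x [p [k [ec rp]]]] : exists x p k, rot k c = x :: p /\ r \notin p.
  have [rc|rc] := boolP (r \in c).
    have [k p ek] := rot_to rc; exists r, p, k; split=> //.
    by move: uc; rewrite -(rot_uniq k) ek => /andP[].
  case: c c2 cc uc rc => // x p _ _ _; rewrite inE negb_or => /andP[_ rp].
  by exists x, p, 0; rewrite rot0.
rewrite -(cycle_edges_rot k uc) ec.
have {}uc : uniq (x :: p) by rewrite -ec rot_uniq.
have {}cc : path.cycle (adj (G :|: H)) (x :: p) by rewrite -ec rot_cycle.
have {}c2 : 2 < size (x :: p) by rewrite -ec size_rot.
wlog Gxp: G H GHr cc / adj G x (head x p).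
  move=> W; have : adj (G :|: H) x (head x p) by case: p cc {c2 rp ec uc W} => [|y p] /= /andP[].
  rewrite /adj inE => /orP[] xp; first exact: (W G H).
  case: (W H G) => //; [by move=> z zH zG; apply: GHr|by rewrite setUC|by right|by left].
left; apply/cyclesP; exists (x :: p); split=> //; apply/andP; split=> //.
case: p rp {ec} uc cc c2 Gxp => // y p ryp uc /= /andP[_ yp] _ xy; rewrite xy.
apply: path_glue GHr _ _ yp => //; apply: (@adj_cover G y x); by rewrite adjC.
Qed.

(** The arguments follow those of [Nd]: [d] is opposite [x], and the two neighbours [a], [b] of [x]
    are interchangeable. The cyclic order is [x], [a], [d], [b]. *)
Definition square x a b d : {set {set T}} :=
  [set [set x; a]; [set x; b]; [set a; d]; [set b; d]].

Lemma square_edges x a b d : uniq [:: x; a; d; b] ->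
  square x a b d = cycle_edges [:: x; a; d; b].
Proof.
rewrite /= !inE !negb_or => /and4P[/and3P[xa xd xb] /andP[ad ab] db _].
apply/setP => e; apply/idP/imsetP.
  rewrite !inE -!orbA => /or4P[]/eqP->.
  - by exists x; rewrite /= ?inE ?eqxx.
  - exists b; first by rewrite !inE eqxx !orbT.
    by rewrite /= eqxx (eq_sym b x) (eq_sym b a) (eq_sym b d) (negbTE xb) (negbTE ab) (negbTE
      db) setUC.
  - exists a; first by rewrite !inE eqxx !orbT.
    by rewrite /= eqxx (eq_sym a x) (negbTE xa).
  - exists d; first by rewrite !inE eqxx !orbT.
    by rewrite /= eqxx (eq_sym d x) (eq_sym d a) (negbTE xd) (negbTE ad) setUC.
case=> z; rewrite !inE -!orbA => /or4P[]/eqP-> ->; rewrite /= ?eqxx //.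
- by rewrite (eq_sym a x) (negbTE xa) eqxx !orbT.
- by rewrite (eq_sym d x) (eq_sym d a) (negbTE xd) (negbTE ad) (setUC [set d]) eqxx !orbT.
- rewrite (eq_sym b x) (eq_sym b a) (eq_sym b d) (negbTE xb) (negbTE ab) (negbTE db).
  by rewrite (setUC [set b]) eqxx !orbT.
Qed.

Lemma square_cycle G x a b d : uniq [:: x; a; d; b] -> square x a b d \subset G ->
  square x a b d \in cycles G.
Proof.
move=> u; rewrite square_edges // => sG.
apply/cyclesP; exists [:: x; a; d; b]; split=> //; apply/andP; split=> //.
by apply: sub_cycle (ucycle_edges u); apply: adj_sub.
Qed.

Lemma cycle_card4 G C : C \in cycles G -> #|C| = 4 -> forall x, x \in cover C ->
  exists a b d, uniq [:: x; a; d; b] /\ C = square x a b d.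
Proof.
case/cyclesP=> c [c2 /andP[_ uc] ->]; rewrite card_cycle_edges // => c4 x.
rewrite cover_cycle_edges inE => /rot_to[k p ek].
have : size (x :: p) = 4 by rewrite -ek size_rot.
have u : uniq (x :: p) by rewrite -ek rot_uniq.
rewrite -(cycle_edges_rot k uc) ek; case: p {ek} u => [//|a [//|d [//|b [|//]]]] u _.
by exists a, b, d; split=> //; rewrite square_edges.
Qed.

End Cycles.

(** * Graphs described by trees *)

Definition apart (T : eqType) (t u : tree T) :=
  forall z, z \in labels t -> z \in labels u -> False.

Ltac apart_absurd := match goal with
  | H : apart ?u ?v, h1 : is_true (?z \in labels ?u), h2 : is_true (?z \in labels ?v)
    |- _ => case: (H z h1 h2) end.

Section Cactus.
Variable T : finType.
Implicit Types (G H C D : {set {set T}}) (x y z a b d : T) (e : {set T}) (t u : tree T).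

(** Connectedness is left out because the induction deletes a cycle and thereby disconnects the
    graph. *)
Definition local_cactus G := forall e, e \in G ->
  exists2 C, [/\ C \in cycles G, e \in C & #|C| = 4] &
    forall D, D \in cycles G -> e \in D -> D = C.

Definition glued G H := exists r, forall z, z \in cover G -> z \in cover H -> z = r.

Lemma coverU G H : cover (G :|: H) = cover G :|: cover H.
Proof. exact: bigcup_setU. Qed.

Lemma sub_cover G H : G \subset H -> cover G \subset cover H.
Proof. by move=> GH; apply/bigcupsP => e eG; apply: bigcup_sup (subsetP GH _ eG). Qed.

Lemma glued_disjoint G H e : glued G H -> e \in G -> e \in H -> #|e| <= 1.
Proof.
case=> r gr eG eH; rewrite -(cards1 r); apply/subset_leq_card/subsetP => z ze.
by rewrite inE; apply/eqP/gr; apply/bigcupP; exists e.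
Qed.

(** A cycle of the union lies on one side, and no edge lies on both, since two distinct ends do not
    fit into one common vertex. *)
Lemma local_cactus_glue G H : (forall e, e \in G -> #|e| = 2) -> glued G H ->
  local_cactus G -> local_cactus H -> local_cactus (G :|: H).
Proof.
move=> G2 gl cG cH; have [r gr] := gl.
have dis e : e \in G -> e \in H -> False.
  by move=> eG eH; have := glued_disjoint gl eG eH; rewrite G2.
move=> e; rewrite inE => /orP[eG|eH].
  have [C [CG eC C4] uC] := cG e eG; exists C.
    by split=> //; apply: cycles_mono CG; apply: subsetUl.
  move=> D /(cycles_glue gr)[DG|DH] eD; first exact: uC.
  by case: (dis e) => //; apply: (subsetP (cycles_sub DH)).
have [C [CG eC C4] uC] := cH e eH; exists C.
  by split=> //; apply: cycles_mono CG; apply: subsetUr.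
move=> D /(cycles_glue gr)[DG|DH] eD; last exact: uC.
by case: (dis e) => //; apply: (subsetP (cycles_sub DG)).
Qed.

Lemma cover_square x a b d : cover (square x a b d) = [set z in [:: x; a; d; b]].
Proof.
apply/setP => z; apply/bigcupP/idP => [[e]|].
  by rewrite !inE -!orbA => /or4P[]/eqP->; rewrite !inE => /orP[]->; rewrite ?orbT.
rewrite !inE => /or4P[]/eqP->; [exists [set x; a]|exists [set x; a]|exists [set a;
  d]|exists [set x; b]];
  by rewrite !inE !eqxx ?orbT.
Qed.

Lemma square_card2 x a b d e : uniq [:: x; a; d; b] -> e \in square x a b d -> #|e| = 2.
Proof.
rewrite /= !inE !negb_or => /and4P[/and3P[xa xd xb] /andP[ad ab] db _].
by rewrite -!orbA => /or4P[]/eqP->; rewrite cards2 ?xa ?xb ?ad 1?eq_sym ?db.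
Qed.

Lemma square_swap x a b d : square x a b d = square x b a d.
Proof. by rewrite /square (setUC [set [set x; a]]) -setUA (setUC [set [set a; d]]) setUA. Qed.

Lemma square_rot x a b d : square x a b d = square a d x b.
Proof.
apply/setP => e; rewrite /square (setUC [set d]) (setUC [set a] [set x]) !inE.
by case: (e == [set x; a]); case: (e == [set x; b]); case: (e == [set a; d]);
  case: (e == [set b; d]).
Qed.

Lemma uniq_swap4 x a b d : uniq [:: x; a; d; b] -> uniq [:: x; b; d; a].
Proof. by rewrite (perm_uniq (_ : perm_eq _ [:: x; b; d; a])) //; apply/seq.permP => P /=;
  lia. Qed.

Lemma uniq_rot4 x a b d : uniq [:: x; a; d; b] -> uniq [:: a; d; b; x].
Proof. by rewrite -(rot_uniq 1). Qed.

Lemma adj_square x a b d y : uniq [:: x; a; d; b] ->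
  adj (square x a b d) x y = (y \in [:: a; b]).
Proof.
rewrite /= !inE !negb_or => /and4P[/and3P[xa xd xb] /andP[ad ab] db _].
rewrite /adj !inE -!orbA; apply/idP/idP => [|/orP[]/eqP->]; rewrite ?eqxx ?orbT //.
by case/or4P=> /eqP/eq_set2[[? ?]|[? ?]]; subst; rewrite ?eqxx ?orbT // in xa xd xb ad ab db *.
Qed.

(* Both edges of a cycle at a vertex lie in the cycle, and every vertex of the
   square has only two edges. *)
Lemma cycles_square x a b d C : uniq [:: x; a; d; b] ->
  C \in cycles (square x a b d) -> C = square x a b d.
Proof.
move=> u CS; apply/eqP; rewrite eqEsubset cycles_sub //=.
case/cyclesP: CS => c [c2 /andP[cc uc] ->].
have nbr z p q r : uniq [:: z; p; r; q] -> square x a b d = square z p q r -> z \in c ->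
   [/\ [set z; p] \in cycle_edges c, [set z; q] \in cycle_edges c, p \in c & q \in c].
  move=> u' es zc; have en : [set z; next c z] \in cycle_edges c.
    exact: (imset_f (fun y => [set y; next c y])).
  have ep : [set z; prev c z] \in cycle_edges c.
    rewrite setUC -{2}(next_prev uc z).
    by apply: (imset_f (fun y => [set y; next c y])); rewrite mem_prev.
  have nc : next c z \in c by rewrite mem_next.
  have pc : prev c z \in c by rewrite mem_prev.
  have := next_prev_neq uc c2 zc.
  have : next c z \in [:: p; q] by rewrite -(adj_square _ u') -es; apply: next_cycle.
  have : prev c z \in [:: p; q].
    by rewrite -(adj_square _ u') -es adjC; apply: prev_cycle.
  rewrite !inE => /orP[]/eqP e1 /orP[]/eqP e2; rewrite e1 e2 ?eqxx // in en ep nc pc *.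
have e1 := square_rot x a b d; have u1 := uniq_rot4 u.
have e2 := square_rot a d x b; have u2 := uniq_rot4 u1.
have e3 := square_rot d b a x; have u3 := uniq_rot4 u2.
have [xc|xc] : x \in c \/ x \notin c by case: (x \in c); [left|right].
  have [xa xb ac bc] := nbr _ _ _ _ u erefl xc.
  have [ad _ _ _] := nbr _ _ _ _ u1 e1 ac.
  have [_ bd _ _] := nbr _ _ _ _ u3 (etrans e1 (etrans e2 e3)) bc.
  by rewrite !subUset !sub1set xa xb ad bd.
suff : x \in c by rewrite (negbTE xc).
case: c c2 cc uc nbr {xc} => // z c _ cc _ nbr.
have : z \in cover (square x a b d).
  by apply: (@adj_cover _ _ _ (next (z :: c) z)); apply: next_cycle cc (mem_head _ _).
have zz : z \in z :: c by rewrite mem_head.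
rewrite cover_square !inE => /or4P[]/eqP ez; move: zz; rewrite {1}ez => zz.
- by rewrite ez eqxx.
- by have [_ _ _] := nbr _ _ _ _ u1 e1 zz; rewrite inE.
- have [_ _ _ ac] := nbr _ _ _ _ u2 (etrans e1 e2) zz.
  by have [_ _ _] := nbr _ _ _ _ u1 e1 ac; rewrite inE.
- by have [_ _ + _] := nbr _ _ _ _ u3 (etrans e1 (etrans e2 e3)) zz; rewrite inE.
Qed.

Fixpoint edges t : {set {set T}} :=
  match t with
  | Lf _ => set0
  | Nd t a b d => square (root t) (root a) (root b) (root d)
      :|: edges t :|: edges a :|: edges b :|: edges d
  end.

Lemma mem_root t : root t \in labels t.
Proof. by rewrite labels_root mem_head. Qed.

Lemma cover_edges t : {subset cover (edges t) <= labels t}.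
Proof.
elim: t => [l|t IHt a IHa b IHb d IHd] z /=; first by rewrite /cover big_set0 inE.
rewrite 4!coverU cover_square !in_setU !inE !mem_cat.
case/orP=> [/orP[/orP[/orP[/or4P[]/eqP->|/IHt->]|/IHa->]|/IHb->]|/IHd->];
  by rewrite ?mem_root ?orbT.
Qed.

Lemma uniq_catP (s1 s2 : seq T) : uniq (s1 ++ s2) ->
  [/\ uniq s1, uniq s2 & forall z, z \in s1 -> z \in s2 -> False].
Proof.
rewrite cat_uniq => /and3P[-> /hasPn h ->]; split=> // z z1 /h /=.
by rewrite z1.
Qed.

Lemma uniq_NdP t ta tb td : uniq (labels (Nd t ta tb td)) ->
  [/\ uniq (labels t), uniq (labels ta), uniq (labels tb) & uniq (labels td)] /\
  [/\ apart t ta, apart t tb & apart t td] /\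
  [/\ apart ta tb, apart ta td & apart tb td].
Proof.
move=> /= /uniq_catP[ut /uniq_catP[ua /uniq_catP[ub ud bd] a_] t_].
split=> //; split; split=> // z z1 z2;
  by [apply: (t_ z) => //; rewrite !mem_cat z2 ?orbT|apply: (a_ z) => //;
    rewrite !mem_cat z2 ?orbT].
Qed.

Lemma apart_root t u : apart t u -> root t != root u.
Proof. by move=> tu; apply/eqP => e; apply: (tu (root t)); rewrite ?mem_root // e mem_root. Qed.

Lemma uniq_roots t ta tb td : uniq (labels (Nd t ta tb td)) ->
  uniq [:: root t; root ta; root td; root tb].
Proof.
case/uniq_NdP=> _ [[/apart_root ? /apart_root ? /apart_root ?] [/apart_root ? /apart_root ?
  /apart_root ?]].
by rewrite /= !inE !negb_or; apply/and4P; split=> //; [apply/and3P|apply/andP|rewrite eq_sym].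
Qed.

(** The graph is assembled piece by piece; each new subtree meets the earlier pieces only in its own
    root, a corner of the square. *)
Lemma glued_Nd t ta tb td (S := square (root t) (root ta) (root tb) (root td)) :
  uniq (labels (Nd t ta tb td)) ->
  [/\ glued S (edges t), glued (S :|: edges t) (edges ta),
      glued (S :|: edges t :|: edges ta) (edges tb) &
      glued (S :|: edges t :|: edges ta :|: edges tb) (edges td)].
Proof.
move=> /uniq_NdP[_ [[t_a t_b t_d] [a_b a_d b_d]]].
have atroot w z : z = root w -> z \in labels w by move->; apply: mem_root.
have sq z : z \in cover S -> [\/ z = root t, z = root ta, z = root td | z = root tb].
  by rewrite cover_square !inE => /or4P[]/eqP ?;
    [constructor 1|constructor 2|constructor 3|constructor 4].
clearbody S.
split; [exists (root t)|exists (root ta)|exists (root tb)|exists (root td)] => z;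
  rewrite ?coverU ?in_setU.
- by case/sq=> // /atroot zr /cover_edges zl; apart_absurd.
- by case/orP=> [/sq[]// /atroot zr|/cover_edges zr] /cover_edges zl; apart_absurd.
- by case/orP=> [/orP[/sq[]// /atroot zr|/cover_edges zr]|/cover_edges zr] /cover_edges zl;
    apart_absurd.
- by case/orP=> [/orP[/orP[/sq[]// /atroot zr|/cover_edges zr]|/cover_edges zr]|/cover_edges
    zr] /cover_edges zl; apart_absurd.
Qed.

Lemma edges_card2 t e : uniq (labels t) -> e \in edges t -> #|e| = 2.
Proof.
elim: t => [l|t IHt a IHa b IHb d IHd]; first by rewrite inE.
move=> u; have r := uniq_roots u; have [[ut ua ub ud] _] := uniq_NdP u.
by rewrite /= 4!in_setU => /orP[/orP[/orP[/orP[/(square_card2 r)|/(IHt ut)]|/(IHa ua)]|/(IHb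
  ub)]|/(IHd ud)].
Qed.

(** Gluing at single vertices creates no cycle across the pieces. *)
Lemma cycles_Nd t ta tb td C (S := square (root t) (root ta) (root tb) (root td)) :
  uniq (labels (Nd t ta tb td)) ->
  (C \in cycles (edges (Nd t ta tb td))) =
  [|| C == S, C \in cycles (edges t), C \in cycles (edges ta), C \in cycles (edges tb)
    | C \in cycles (edges td)].
Proof.
move=> u; have r := uniq_roots u; have [[r1 g1] [r2 g2] [r3 g3] [r4 g4]] := glued_Nd u.
apply/idP/idP => [/=|].
  case/(cycles_glue g4)=> [/(cycles_glue g3)[/(cycles_glue g2)[/(cycles_glue
    g1)[/(cycles_square r)->|->]|->]|->]|->];
  by rewrite ?eqxx ?orbT.
case/orP=> [/eqP->|].
  by apply: square_cycle => //; apply/subsetP => e eS /=; rewrite 4!in_setU eS.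
by case/or4P; apply: cycles_mono; apply/subsetP => e /=; rewrite !in_setU => ->; rewrite ?orbT.
Qed.

Lemma edges_local_cactus t : uniq (labels t) -> local_cactus (edges t).
Proof.
elim: t => [l _ e|t IHt a IHa b IHb d IHd u]; first by rewrite inE.
have r := uniq_roots u; have [[ut ua ub ud] _] := uniq_NdP u.
have e2 e (E : e \in edges (Nd t a b d)) := edges_card2 u E.
have [g1 g2 g3 g4] := glued_Nd u.
set S := square _ _ _ _ in g1 g2 g3 g4.
have c0 : local_cactus S.
  move=> e eS; exists S; last by move=> D DS _; apply: cycles_square.
  split=> //; first exact: square_cycle.
  by rewrite /S square_edges // card_cycle_edges.
have s3 : S :|: edges t :|: edges a :|: edges b \subset edges (Nd t a b d) by apply: subsetUl.
have s2 := subset_trans (subsetUl _ _) s3; have s1 := subset_trans (subsetUl _ _) s2.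
have s0 := subset_trans (subsetUl _ _) s1.
have c1 := local_cactus_glue (fun e eG => e2 e (subsetP s0 e eG)) g1 c0 (IHt ut).
have c2 := local_cactus_glue (fun e eG => e2 e (subsetP s1 e eG)) g2 c1 (IHa ua).
have c3 := local_cactus_glue (fun e eG => e2 e (subsetP s2 e eG)) g3 c2 (IHb ub).
exact: local_cactus_glue (fun e eG => e2 e (subsetP s3 e eG)) g4 c3 (IHd ud).
Qed.

End Cactus.

(** * Existence and uniqueness of the tree of a cactus *)

Section Decomposition.
Variable T : finType.
Implicit Types (G H C D : {set {set T}}) (x y z a b d : T) (e : {set T}) (t u : tree T).

Lemma connect_edges t x : x \in labels t -> connect (adj (edges t)) (root t) x.
Proof.
have sub u G : edges u \subset G -> x \in labels u ->
    (x \in labels u -> connect (adj (edges u)) (root u) x) -> connect (adj G) (root u) x.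
  move=> uG xu /(_ xu); apply: connect_sub => y z yz; apply: connect1.
  exact: adj_sub uG _ _ yz.
elim: t => [l|t IHt ta IHa tb IHb td IHd]; first by rewrite inE => /eqP->.
have S y z : [set y; z] \in square (root t) (root ta) (root tb) (root td) ->
    connect (adj (edges (Nd t ta tb td))) y z.
  by move=> yz; apply: connect1; rewrite /adj /= 4!in_setU yz.
have sub4 u : [\/ u = t, u = ta, u = tb | u = td] -> edges u \subset edges (Nd t ta tb td).
  by move=> ue; apply/subsetP => e eu /=; rewrite 4!in_setU; case: ue eu => -> ->; rewrite ?orbT.
have Sa : connect (adj (edges (Nd t ta tb td))) (root t) (root ta).
  by apply: S; rewrite !inE eqxx.
rewrite [labels _]/= !mem_cat => /or4P[] xu.
- by apply: sub xu IHt; apply: sub4; constructor 1.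
- by apply: connect_trans Sa _; apply: sub xu IHa; apply: sub4; constructor 2.
- apply: (connect_trans (S _ (root tb) _)); first by rewrite !inE eqxx !orbT.
  by apply: sub xu IHb; apply: sub4; constructor 3.
- apply: connect_trans Sa _; apply: (connect_trans (S _ (root td) _)).
    by rewrite !inE eqxx !orbT.
  by apply: sub xu IHd; apply: sub4; constructor 4.
Qed.

(** Closed by the edge from [y] to [x], the path is a cycle, and [C] is the only cycle through that
    edge. The bound on [size p] excludes the path that merely runs along the edge. *)
Lemma closing_path_cycle G C x y p : local_cactus G -> C \in cycles G -> [set y; x] \in C ->
  path (adj G) x p -> uniq (x :: p) -> last x p = y -> 1 < size p -> cycle_edges (x :: p) = C.
Proof.
move=> cG CG yxC xp u ey p2; have yxG := subsetP (cycles_sub CG) _ yxC.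
have [D [DG _ _] uD] := cG _ yxG; rewrite (uD _ CG yxC); apply: uD.
  apply/cyclesP; exists (x :: p); split=> //; apply/andP; split=> //.
  by rewrite /= rcons_path xp ey.
have : [set prev (x :: p) x; next (x :: p) (prev (x :: p) x)] \in cycle_edges (x :: p).
  by apply: (imset_f (fun y => [set y; next (x :: p) y])); rewrite mem_prev mem_head.
by rewrite next_prev // prev_head ?ey //; case/andP: u.
Qed.

(** A simple path from [x] to [a] outside [C] would close with the edge [[set x; a]] to a cycle,
    necessarily [C]; but its first edge is not in [C]. *)
Lemma disconnected_adj G x a b d (C := square x a b d) : local_cactus G ->
  uniq [:: x; a; d; b] -> C \in cycles G -> ~~ connect (adj (G :\: C)) x a.
Proof.
move=> cG u CG; apply/negP => /connectP[p0 xp0 ea].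
move: ea; case/shortenP: xp0 => p xp up _ ea {p0}.
have xaC : [set x; a] \in C by rewrite !inE eqxx.
case: p ea xp up => [ea|y [/= ea|z p]].
- by move: u; rewrite ea /= !inE eqxx.
- by rewrite -ea /adj !inE eqxx.
move=> ea xp up; have /andP[] := xp; rewrite {1}/adj in_setD => /andP[/negP xyC _] _; case: xyC.
rewrite -(@closing_path_cycle G C x a [:: y, z & p]) //; last 2 first.
- by rewrite setUC.
- by apply: sub_path xp; apply: adj_sub; apply: subsetDl.
by apply/imsetP; exists x; rewrite ?mem_head //= eqxx.
Qed.

(** No edge of [C] joins [x] to [d], so the simple path is prolonged by the edge from [d] to [a]
    before closing. It does not visit [a] earlier, since [x] and [a] are already separated. *)
Lemma disconnected_opp G x a b d (C := square x a b d) : local_cactus G ->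
  uniq [:: x; a; d; b] -> C \in cycles G -> ~~ connect (adj (G :\: C)) x d.
Proof.
move=> cG u CG; have nxa := disconnected_adj cG u CG.
apply/negP => /connectP[p0 xp0 ed]; move: ed; case/shortenP: xp0 => p xp up _ ed {p0}.
have ap : a \notin x :: p by apply: contra nxa => /(path_connect xp).
have adC : [set a; d] \in C by rewrite !inE eqxx !orbT.
have xpG : path (adj G) x p by apply: sub_path xp; apply: adj_sub; apply: subsetDl.
case: p ed xp up xpG ap => [ed|y p ed xp up xpG ap].
  by move: u; rewrite ed /= !inE eqxx !orbT.
have /andP[] := xp; rewrite {1}/adj in_setD => /andP[/negP xyC _] _; case: xyC.
rewrite -(@closing_path_cycle G C x a (rcons (y :: p) a)) ?last_rcons ?size_rcons //;
  last 3 first.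
- by rewrite setUC !inE eqxx.
- by rewrite rcons_path xpG -ed /adj setUC (subsetP (cycles_sub CG)).
- by rewrite -rcons_cons rcons_uniq ap.
by apply/imsetP; exists x; rewrite ?mem_head //= eqxx.
Qed.

(** Cycles that share an edge coincide, so the cycle of an edge outside [C] loses none of its
    edges. *)
Lemma local_cactusD G C : local_cactus G -> C \in cycles G -> local_cactus (G :\: C).
Proof.
move=> cG CG e; rewrite inE => /andP[eC eG]; have [D [DG eD D4] uD] := cG e eG.
exists D; last by move=> D' D'G; apply: uD; apply: cycles_mono D'G; apply: subsetDl.
split=> //; apply: cycles_subr (DG) _; apply/subsetP => f fD; rewrite inE.
rewrite (subsetP (cycles_sub DG)) // andbT; apply: contra eC => fC.
have [F _ uF] := cG f (subsetP (cycles_sub DG) _ fD).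
by rewrite (uF C) // -(uF D).
Qed.

(** As the graph of a tree is connected, this says that [t] describes the whole component of its
    root in [G]. *)
Definition fills t G := edges t \subset G /\
  forall x y, x \in labels t -> [set x; y] \in G -> [set x; y] \in edges t.

Lemma fills_connect t u G z : edges t \subset G -> edges u \subset G ->
  z \in labels t -> z \in labels u -> connect (adj G) (root t) (root u).
Proof.
have sub v : edges v \subset G -> z \in labels v -> connect (adj G) (root v) z.
  move=> vG /connect_edges; apply: connect_sub => x y xy; apply: connect1.
  exact: adj_sub vG _ _ xy.
move=> tG uG zt zu; apply: connect_trans (sub t tG zt) _.
by rewrite connectC sub.
Qed.

(** Without [C] its corners lie in four different components, so the trees of these components are
    pairwise apart and [Nd] joins them around [C]. Rotating the square reduces all six pairs of
    corners to an adjacent or an opposite pair. *)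
Lemma fill_cycle G C v : local_cactus G -> C \in cycles G -> #|C| = 4 -> v \in cover C ->
  (forall w, exists t, [/\ root t = w, uniq (labels t) & fills t (G :\: C)]) ->
  exists t ta tb td, [/\ root t = v, uniq (labels (Nd t ta tb td)),
    square (root t) (root ta) (root tb) (root td) = C & fills (Nd t ta tb td) G].
Proof.
move=> cG CG C4 vC fill; have [a [b [d [u eC]]]] := cycle_card4 CG C4 vC.
have [t [rt ut [st ft]]] := fill v; have [ta [ra ua [sa fa]]] := fill a.
have [tb [rb ub [sb fb]]] := fill b; have [td [rd ud [sd fd]]] := fill d.
exists t, ta, tb, td; rewrite rt ra rb rd -eC.
have ap x y (tx ty : tree T) : root tx = x -> root ty = y -> edges tx \subset G :\: C ->
    edges ty \subset G :\: C -> ~~ connect (adj (G :\: C)) x y -> apart tx ty.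
  by move=> <- <- sx sy /negP nc z zx zy; case: nc; apply: fills_connect zy.
have e1 := etrans eC (square_rot v a b d); have u1 := uniq_rot4 u.
have e2 := etrans e1 (square_rot a d v b); have u2 := uniq_rot4 u1.
have e3 := etrans e2 (square_rot d b a v); have u3 := uniq_rot4 u2.
have t_a : apart t ta by apply: ap rt ra st sa _; rewrite eC disconnected_adj // -eC.
have t_d : apart t td by apply: ap rt rd st sd _; rewrite eC disconnected_opp // -eC.
have t_b : apart t tb.
  by apply: ap rt rb st sb _; rewrite connectC e3 disconnected_adj // -e3.
have a_d : apart ta td by apply: ap ra rd sa sd _; rewrite e1 disconnected_adj // -e1.
have a_b : apart ta tb by apply: ap ra rb sa sb _; rewrite e1 disconnected_opp // -e1.
have d_b : apart td tb by apply: ap rd rb sd sb _; rewrite e2 disconnected_adj // -e2.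
have CsubG := cycles_sub CG.
split=> //.
- rewrite /= !cat_uniq ut ua ub ud /= !andbT; apply/and3P; split; apply/hasPn => z /=.
  + by rewrite !mem_cat => /or3P[] zl; apply/negP => zr; apart_absurd.
  + by rewrite !mem_cat => /orP[] zl; apply/negP => zr; apart_absurd.
  + by move=> zl; apply/negP => zr; apart_absurd.
- have GC : G :\: C \subset G by apply: subsetDl.
  split=> [|x y]; first by rewrite /= 4!subUset rt ra rb rd -eC CsubG !(subset_trans _ GC).
  move=> xl xyG; rewrite [edges _]/= 4!in_setU rt ra rb rd -eC.
  have [//|xyC] := boolP ([set x; y] \in C).
  have xyD : [set x; y] \in G :\: C by rewrite inE xyC.
  move: xl; rewrite /= !mem_cat => /or4P[/ft|/fa|/fb|/fd] ->//; by rewrite ?orbT.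
Qed.

(** Induction on the number of edges, deleting a cycle through [v]; a vertex without edges is a
    leaf. *)
Lemma fill_exists G v : local_cactus G ->
  exists t, [/\ root t = v, uniq (labels t) & fills t G].
Proof.
have [k] := ubnP #|G|; elim: k G v => // k IH G v; rewrite ltnS => Gk cG.
have [/bigcupP[e eG ve]|nv] := boolP (v \in cover G); last first.
  exists (Lf v); split=> //; split=> [|x y]; first exact: sub0set.
  rewrite inE => /eqP-> vy; case/negP: nv; exact: (adj_cover vy).
have [C [CG eC C4] _] := cG e eG.
have [] := @fill_cycle G C v cG CG C4.
- by apply/bigcupP; exists e.
- move=> w; apply: IH; last exact: local_cactusD.
  apply: leq_trans Gk; apply: proper_card; apply/properP; split; first exact: subsetDl.
  by exists e => //; rewrite inE eC.
- by move=> t [ta [tb [td [rt u _ f]]]]; exists (Nd t ta tb td).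
Qed.

End Decomposition.

Section Uniqueness.
Variable T : finType.
Implicit Types (G H C D : {set {set T}}) (x y z a b d : T) (e : {set T}) (t u : tree T).

Lemma edges_teq t u : teq t u -> edges t = edges u.
Proof.
elim=> {t u} //.
- by move=> t u v _ -> _ ->.
- by move=> t ta tb td /=; rewrite square_swap -!setUA (setUCA (edges ta)).
- move=> t ta tb td ta' tb' td' /=; move: (square _ _ _ _) (square _ _ _ _) => S S'.
  apply/setP => e; rewrite !in_setU.
  by do 9 case: (e \in _).
- move=> t ta tb td t' ta' tb' td' /= tt et aa ea bb eb dd ed.
  by rewrite (root_teq tt) (root_teq aa) (root_teq bb) (root_teq dd) et ea eb ed.
Qed.

(** The graph of a tree is connected, there is no passage between vertex-disjoint [G] and [H], and
    the root is not on the side of [H]. *)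
Lemma edges_subl t G H : edges t \subset G :|: H ->
  (forall z, z \in cover G -> z \in cover H -> False) -> root t \notin cover H ->
  edges t \subset G.
Proof.
move=> + GH; elim: t => [l _ _|t IHt ta IHa tb IHb td IHd]; first exact: sub0set.
rewrite [edges _]/= 4!subUset -!andbA [root _]/= => /and5P[sS st sa sb sd] rt.
have stepr x y : x \notin cover H -> [set x;
  y] \in square (root t) (root ta) (root tb) (root td) ->
    [set x; y] \in G /\ y \notin cover H.
  move=> xH /(subsetP sS); rewrite inE => /orP[xyG|/adj_cover xH']; last by rewrite xH' in xH.
  split=> //; apply/negP; apply: GH; apply: (@adj_cover _ _ _ x); by rewrite /adj setUC.
have [|xaG ra] := @stepr _ (root ta) rt; first by rewrite !inE eqxx.
have [|xbG rb] := @stepr _ (root tb) rt; first by rewrite !inE eqxx !orbT.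
have [|adG rd] := @stepr _ (root td) ra; first by rewrite !inE eqxx !orbT.
have [|bdG _] := @stepr _ (root td) rb; first by rewrite !inE eqxx !orbT.
by rewrite 4!subUset IHt // IHa // IHb // IHd // !andbT !subUset !sub1set xaG xbG adG bdG.
Qed.

Lemma edges_squareD t ta tb td (S := square (root t) (root ta) (root tb) (root td)) e :
  uniq (labels (Nd t ta tb td)) ->
  e \in edges t :|: edges ta :|: edges tb :|: edges td -> e \notin S.
Proof.
move=> u; have [g1 g2 g3 g4] := glued_Nd u; rewrite 3!in_setU => ee; apply/negP => eS.
have off G v : glued G (edges v) -> e \in G -> e \in edges v -> uniq (labels v) -> False.
  by move=> g eG ev uv; have := glued_disjoint g eG ev; rewrite (edges_card2 uv ev).
have [[ut ua ub ud] _] := uniq_NdP u.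
case/orP: ee => [/orP[/orP[]|]|] ev.
- exact: off g1 eS ev ut.
- by apply: off g2 _ ev ua; rewrite in_setU eS.
- by apply: off g3 _ ev ub; rewrite 2!in_setU eS.
- by apply: off g4 _ ev ud; rewrite 3!in_setU eS.
Qed.

(** Equal roots give equal squares. Once the square is removed, the four pieces are vertex-disjoint,
    and each is recognised by its root. *)
Lemma edges_Nd_inj t ta tb td t' ta' tb' td' :
  uniq (labels (Nd t ta tb td)) -> uniq (labels (Nd t' ta' tb' td')) ->
  edges (Nd t ta tb td) = edges (Nd t' ta' tb' td') ->
  root t = root t' -> root ta = root ta' -> root tb = root tb' -> root td = root td' ->
  [/\ edges t = edges t', edges ta = edges ta', edges tb = edges tb' & edges td = edges td'].
Proof.
move=> u u' ee rt ra rb rd.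
suff half (s sa sb sd s' sa' sb' sd' : tree T) : uniq (labels (Nd s sa sb sd)) ->
  uniq (labels (Nd s' sa' sb' sd')) ->
    edges (Nd s sa sb sd) = edges (Nd s' sa' sb' sd') ->
    root s = root s' -> root sa = root sa' -> root sb = root sb' -> root sd = root sd' ->
    [/\ edges s \subset edges s', edges sa \subset edges sa',
        edges sb \subset edges sb' & edges sd \subset edges sd'].
  have [h1 h2 h3 h4] := half _ _ _ _ _ _ _ _ u u' ee rt ra rb rd.
  have [k1 k2 k3 k4] := half _ _ _ _ _ _ _ _ u' u (esym ee) (esym rt) (esym ra) (esym rb) (esym
    rd).
  by split; apply/eqP; rewrite eqEsubset ?h1 ?h2 ?h3 ?h4.
move=> {u u' ee rt ra rb rd t ta tb td t' ta' tb' td'} u u' ee rt ra rb rd.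
have sub : edges s :|: edges sa :|: edges sb :|: edges sd \subset
           edges s' :|: edges sa' :|: edges sb' :|: edges sd'.
  apply/subsetP => e el; have /= eS := edges_squareD u el.
  have : e \in edges (Nd s sa sb sd).
    rewrite /=; move: (square _ _ _ _) el => S0.
    by rewrite !in_setU => /orP[/orP[/orP[]|]|] ->; rewrite ?orbT.
  rewrite ee /= -rt -ra -rb -rd; move: (square _ _ _ _) eS => S0 eS.
  by rewrite !in_setU (negbTE eS).
have [_ [[t_a t_b t_d] [a_b a_d b_d]]] := uniq_NdP u'.
have mr (v : tree T) := mem_root v.
move: sub; rewrite 3!subUset -!andbA => /and4P[s1 s2 s3 s4]; split.
- apply: (@edges_subl _ _ (edges sa' :|: edges sb' :|: edges sd')); rewrite ?setUA //.
    by move=> z /cover_edges zl; rewrite !coverU !in_setU => /orP[/orP[]|] /cover_edges zr;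
      apart_absurd.
  by rewrite !coverU !in_setU rt; apply/negP => /orP[/orP[]|] /cover_edges zr;
    have zl := mr s'; apart_absurd.
- apply: (@edges_subl _ _ (edges s' :|: edges sb' :|: edges sd')).
  + by apply: subset_trans s2 _; apply/subsetP => e; rewrite !in_setU; do 4 case: (e \in _).
  + by move=> z /cover_edges zl; rewrite !coverU !in_setU => /orP[/orP[]|] /cover_edges zr;
      apart_absurd.
  + by rewrite !coverU !in_setU ra; apply/negP => /orP[/orP[]|] /cover_edges zr;
      have zl := mr sa'; apart_absurd.
- apply: (@edges_subl _ _ (edges s' :|: edges sa' :|: edges sd')).
  + by apply: subset_trans s3 _; apply/subsetP => e; rewrite !in_setU; do 4 case: (e \in _).
  + by move=> z /cover_edges zl; rewrite !coverU !in_setU => /orP[/orP[]|] /cover_edges zr;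
      apart_absurd.
  + by rewrite !coverU !in_setU rb; apply/negP => /orP[/orP[]|] /cover_edges zr;
      have zl := mr sb'; apart_absurd.
- apply: (@edges_subl _ _ (edges s' :|: edges sa' :|: edges sb')).
  + by apply: subset_trans s4 _; apply/subsetP => e; rewrite !in_setU; do 4 case: (e \in _).
  + by move=> z /cover_edges zl; rewrite !coverU !in_setU => /orP[/orP[]|] /cover_edges zr;
      apart_absurd.
  + by rewrite !coverU !in_setU rd; apply/negP => /orP[/orP[]|] /cover_edges zr;
      have zl := mr sd'; apart_absurd.
Qed.

Lemma square_inj x a b d a' b' d' : uniq [:: x; a; d; b] -> uniq [:: x; a'; d'; b'] ->
  square x a b d = square x a' b' d' ->
  d = d' /\ ((a = a' /\ b = b') \/ (a = b' /\ b = a')).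
Proof.
move=> u u' es; have ma : a \in [:: a'; b'].
  by rewrite -(adj_square _ u') -es adj_square // !inE eqxx.
have mb : b \in [:: a'; b'].
  by rewrite -(adj_square _ u') -es adj_square // !inE eqxx orbT.
have [ab xd] : a != b /\ d != x.
  move: u; rewrite /= !inE !negb_or => /and4P[/and3P[_ xd _] /andP[_ ab] _ _].
  by split=> //; rewrite eq_sym.
have ad : adj (square x a' b' d') a d.
  by rewrite -es (square_rot x) (adj_square _ (uniq_rot4 u)) !inE eqxx.
move: ma mb ad; rewrite !inE => /orP[]/eqP ea /orP[]/eqP eb; rewrite ea eb ?eqxx // in ab *.
  rewrite (square_rot x) (adj_square _ (uniq_rot4 u')) !inE (negbTE xd) orbF => /eqP->.
  by split=> //; left.
rewrite (square_swap x) (square_rot x) (adj_square _ (uniq_rot4 (uniq_swap4 u'))) !inE (negbTE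
  xd) orbF => /eqP->.
by split=> //; right.
Qed.

(** Only the first argument of [Nd] contains the root, so a cycle through the root is the outermost
    one or lies in that argument; in the latter case [teq_comm] brings it outwards. *)
Lemma cycle_front t a b d : uniq (labels t) -> uniq [:: root t; a; d; b] ->
  square (root t) a b d \in cycles (edges t) ->
  exists t0 ta tb td, [/\ teq t (Nd t0 ta tb td), root ta = a, root tb = b & root td = d].
Proof.
elim: t => [l _ u|t IHt ta _ tb _ td _ u r].
  move=> /cycles_sub/subsetP/(_ [set l; a]); by rewrite !inE eqxx => /(_ isT).
have [[ut _ _ _] [[t_a t_b t_d] _]] := uniq_NdP u.
have mt : root t \in cover (square (root t) a b d) by rewrite cover_square !inE eqxx.
have no v (P : Prop) : apart t v -> square (root t) a b d \in cycles (edges v) -> P.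
  move=> tv /cycles_sub/sub_cover/subsetP/(_ _ mt)/cover_edges zr.
  by have zl := mem_root t; apart_absurd.
rewrite cycles_Nd // => /orP[/eqP es|/or4P[/(IHt ut r)|||]]; last 3 first.
- exact: no t_a.
- exact: no t_b.
- exact: no t_d.
- have [-> [[-> ->]|[-> ->]]] := square_inj r (uniq_roots u) es.
    by exists t, ta, tb, td.
  by exists t, tb, ta, td; split=> //; apply: teq_swap.
case=> t0 [ta' [tb' [td' [tt ra rb rd]]]]; exists (Nd t0 ta tb td), ta', tb', td'; split=> //.
by apply: teq_trans (teq_comm _ _ _ _ _ _ _); apply: teq_cong.
Qed.

(** [cycle_front] rearranges [u] until its outermost cycle has the same corners as that of [t]; the
    induction then runs on the four pieces. *)
Lemma edges_inj t u : uniq (labels t) -> uniq (labels u) -> root t = root u ->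
  edges t = edges u -> teq t u.
Proof.
elim: t u => [l|t IHt ta IHa tb IHb td IHd] u ut uu ru eu.
  case: u uu ru eu => [l' _ /= -> //|u ua ub ud _ _ /setP/(_ [set root u; root ua])].
  by rewrite [edges (Nd _ _ _ _)]/= 4!in_setU !inE !eqxx.
have [] := @cycle_front u (root ta) (root tb) (root td) uu.
- by rewrite -ru; apply: uniq_roots ut.
- by rewrite -eu -ru cycles_Nd //; apply/orP; left; apply/eqP.
move=> t0 [ta' [tb' [td' [uN ra rb rd]]]].
have uN' : uniq (labels (Nd t0 ta' tb' td')) by rewrite -(perm_uniq (perm_labels uN)).
have rt : root t = root t0 by rewrite -[root t0]/(root (Nd t0 ta' tb' td')) -(root_teq uN) -ru.
have eN : edges (Nd t ta tb td) = edges (Nd t0 ta' tb' td') by rewrite eu (edges_teq uN).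
have [et ea eb ed] := edges_Nd_inj ut uN' eN rt (esym ra) (esym rb) (esym rd).
have [[t1 t2 t3 t4] _] := uniq_NdP ut; have [[t1' t2' t3' t4'] _] := uniq_NdP uN'.
apply: teq_trans (teq_sym uN); apply: teq_cong; [exact: IHt|exact: IHa|exact: IHb|exact: IHd].
Qed.

End Uniqueness.

(** * Trees with a distinguished cycle *)

Definition quad (L : Type) : Type := (tree L * tree L * tree L * tree L)%type.

Definition nd L (p : quad L) : tree L := let: (t, a, b, d) := p in Nd t a b d.

Definition qmap L L' (f : L -> L') (p : quad L) : quad L' :=
  let: (t, a, b, d) := p in (tmap f t, tmap f a, tmap f b, tmap f d).

Definition qrot L (p : quad L) : quad L := let: (t, a, b, d) := p in (a, d, t, b).

(** A quad presents a tree with a cycle and a corner of that cycle. This equivalence forgets the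
    cycle, [flag_eq] keeps both, and [cycle_eq] forgets the corner. *)
Definition vertex_eq L (p q : quad L) : Prop := teq (nd p) (nd q).

Definition flag_eq L (p q : quad L) : Prop :=
  let: (t, a, b, d) := p in let: (t', a', b', d') := q in
  [/\ teq t t', teq d d' & (teq a a' /\ teq b b') \/ (teq a b' /\ teq b a')].

(** The rotations and the reflection built into [flag_eq] generate all symmetries of a 4-cycle. *)
Definition cycle_eq L (p q : quad L) : Prop := exists k, flag_eq p (iter k (@qrot L) q).

Definition qsquare (T : finType) (p : quad T) : {set {set T}} :=
  let: (t, a, b, d) := p in square (root t) (root a) (root b) (root d).

Lemma nd_qmap L L' (f : L -> L') (p : quad L) : nd (qmap f p) = tmap f (nd p).
Proof. by case: p => [[[]]]. Qed.

Lemma qrotK L (p : quad L) : iter 4 (@qrot L) p = p.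
Proof. by case: p => [[[]]]. Qed.

Lemma qrot_iterK L k (p : quad L) : iter (3 * k) (@qrot L) (iter k (@qrot L) p) = p.
Proof.
rewrite -iterD -mulSnr mulnC; elim: k => // k IH.
by rewrite mulSn iterD IH qrotK.
Qed.

Section Quads.
Variables L L' : Type.
Implicit Types (p q : quad L) (f : L -> L').

Lemma flag_eq_refl p : flag_eq p p.
Proof. by case: p => [[[t a] b] d]; split=> //; left. Qed.

Lemma flag_teq p q : flag_eq p q -> teq (nd p) (nd q).
Proof.
case: p q => [[[t a] b] d] [[[t' a'] b'] d'] [tt dd [[aa bb]|[ab ba]]]; first exact: teq_cong.
by apply: teq_trans (teq_swap _ _ _ _) _; apply: teq_cong.
Qed.

Lemma vertex_eq_lift f p (q : quad L') : vertex_eq (qmap f p) q ->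
  exists2 p', vertex_eq p p' & qmap f p' = q.
Proof.
rewrite /vertex_eq nd_qmap => /teq_lift[[l|t a b d] pp] //; case: q =>
  [[[t' a'] b'] d'] //= [<- <- <- <-].
by exists (t, a, b, d).
Qed.

Lemma flag_eq_lift f p (q : quad L') : flag_eq (qmap f p) q ->
  exists2 p', flag_eq p p' & qmap f p' = q.
Proof.
case: p q => [[[t a] b] d] [[[t' a'] b'] d'] /= [/teq_lift[t1 tt <-] /teq_lift[d1 dd <-]].
case=> -[/teq_lift[a1 aa <-] /teq_lift[b1 bb <-]].
  by exists (t1, a1, b1, d1) => //; split=> //; left.
by exists (t1, b1, a1, d1) => //; split=> //; right.
Qed.

Lemma qmap_rot f p : qmap f (qrot p) = qrot (qmap f p).
Proof. by case: p => [[[]]]. Qed.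

Lemma cycle_eq_lift f p (q : quad L') : cycle_eq (qmap f p) q ->
  exists2 p', cycle_eq p p' & qmap f p' = q.
Proof.
case=> k /flag_eq_lift[p' pp' ek]; have ej := qrot_iterK k q.
exists (iter (3 * k) (@qrot L) p').
  (* The lifted quad has been turned [3 * k] times; [3 * (3 * k)] more turns complete a multiple of
     4. *)
  by exists (3 * (3 * k)); rewrite qrot_iterK.
rewrite -ej -ek; elim: (3 * k) => //= j <-; exact: qmap_rot.
Qed.

End Quads.

Lemma perm_labels_rot (L : eqType) (p : quad L) : perm_eq (labels (nd (qrot p))) (labels (nd p)).
Proof. by case: p => [[[t a] b] d]; apply/seq.permP => x /=; rewrite !count_cat; lia. Qed.

Lemma perm_labels_cycle (L : eqType) (p q : quad L) : cycle_eq p q ->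
  perm_eq (labels (nd p)) (labels (nd q)).
Proof.
case=> k /flag_teq/perm_labels; elim: k q => //= k IH q /perm_trans; apply.
by apply: perm_trans (perm_labels_rot _) _; elim: k {IH} => //= k;
  apply: perm_trans (perm_labels_rot _).
Qed.

Section QuadGraphs.
Variable T : finType.
Implicit Types (p q : quad T).

Lemma flag_eq_graph p q : flag_eq p q ->
  [/\ edges (nd p) = edges (nd q), qsquare p = qsquare q & root (nd p) = root (nd q)].
Proof.
move=> pq; have tpq := flag_teq pq; split; [exact: edges_teq| |exact: root_teq].
case: p q pq {tpq} => [[[t a] b] d] [[[t' a'] b'] d'] [/root_teq rt /root_teq rd]/=.
by case=> -[/root_teq ra /root_teq rb]; rewrite rt ra rb rd // square_swap.
Qed.

(** A square and one of its corners fix the opposite corner and leave two orders of the neighbours,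
    the two alternatives of [flag_eq]. *)
Lemma flag_eqP p q : uniq (labels (nd p)) -> uniq (labels (nd q)) ->
  edges (nd p) = edges (nd q) -> qsquare p = qsquare q -> root (nd p) = root (nd q) ->
  flag_eq p q.
Proof.
case: p q => [[[t a] b] d] [[[t' a'] b'] d'] up uq.
have R t1 a1 b1 d1 : uniq (labels (Nd t1 a1 b1 d1)) ->
    edges (Nd t a b d) = edges (Nd t1 a1 b1 d1) -> root t = root t1 -> root a = root a1 ->
    root b = root b1 -> root d = root d1 -> [/\ teq t t1, teq a a1, teq b b1 & teq d d1].
  move=> u1 e1 rt ra rb rd; have [et ea eb ed] := edges_Nd_inj up u1 e1 rt ra rb rd.
  have [[? ? ? ?] _] := uniq_NdP up; have [[? ? ? ?] _] := uniq_NdP u1.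
  by split; apply: edges_inj.
rewrite [nd _]/= [nd (t', _, _, _)]/= => epq sq rt; rewrite /= in rt sq.
have r1 := uniq_roots up; have r2 := uniq_roots uq; rewrite -rt in r2 sq.
have [rd [[ra rb]|[ra rb]]] := square_inj r1 r2 sq.
  by have [? ? ? ?] := R _ _ _ _ uq epq rt ra rb rd; split=> //; left.
have sw := @teq_swap T t' a' b' d'.
have [||? ? ? ?] := R t' b' a' d' _ _ rt ra rb rd.
- by rewrite -(perm_uniq (perm_labels sw)).
- by rewrite epq; apply: edges_teq.
by split=> //; right.
Qed.

Lemma qrot_graph q : edges (nd (qrot q)) = edges (nd q) /\ qsquare (qrot q) = qsquare q.
Proof.
case: q => [[[t a] b] d] /=; rewrite -square_rot; split=> //.
move: (square _ _ _ _) => S; apply/setP => e; rewrite !in_setU.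
by do 5 case: (e \in _).
Qed.

Lemma iter_qrot_graph k q :
  edges (nd (iter k (@qrot T) q)) = edges (nd q) /\ qsquare (iter k (@qrot T) q) = qsquare q.
Proof.
elim: k => //= k [<- <-]; exact: qrot_graph.
Qed.

Lemma cycle_eq_graph p q : cycle_eq p q ->
  edges (nd p) = edges (nd q) /\ qsquare p = qsquare q.
Proof. by case=> k /flag_eq_graph[-> -> _]; apply: iter_qrot_graph. Qed.

(** The root of [p] is a corner of the common square, so some rotation of [q] has the same root. *)
Lemma cycle_eqP p q : uniq (labels (nd p)) -> uniq (labels (nd q)) ->
  edges (nd p) = edges (nd q) -> qsquare p = qsquare q -> cycle_eq p q.
Proof.
move=> up uq ee es.
have [k rk] : exists k, root (nd p) = root (nd (iter k (@qrot T) q)).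
  have : root (nd p) \in cover (qsquare q).
    by rewrite -es; case: p {up ee es} => [[[t a] b] d]; rewrite cover_square !inE eqxx.
  case: q {uq ee es} => [[[t a] b] d]; rewrite cover_square !inE => /or4P[]/eqP->.
  - by exists 0.
  - by exists 1.
  - by exists 2.
  - by exists 3.
exists k; have [ek sk] := iter_qrot_graph k q; apply: flag_eqP; rewrite ?ek ?sk //.
rewrite -(perm_uniq (_ : perm_eq (labels (nd q)) _)) //.
by apply: perm_labels_cycle; exists (3 * k); rewrite qrot_iterK; apply: flag_eq_refl.
Qed.

End QuadGraphs.

Lemma teq_tmap L L' (f : L -> L') (t u : tree L) : teq t u -> teq (tmap f t) (tmap f u).
Proof.
elim=> {t u} //=.
- by move=> t u v _ h _; apply: teq_trans.
- by move=> *; apply: teq_swap.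
- by move=> *; apply: teq_comm.
- by move=> *; apply: teq_cong.
Qed.

Lemma has_card_bij (K : choiceType) (P : pred K) (I : finType) (f : I -> K) :
  injective f -> (forall x, P x <-> exists i, f i = x) -> has_card P #|I|.
Proof.
move=> fI fP; exists [fset x in map f (enum I)]%fset => [x|].
  rewrite inE; apply/mapP/idP => [[i _ ->]|/fP[i <-]]; first by apply/fP; exists i.
  by exists i; rewrite ?mem_enum.
rewrite card_fseq undup_id; first by rewrite size_map -cardT.
by rewrite map_inj_uniq ?enum_uniq.
Qed.

(** * Orbits of graphs and objects *)

Section GraphAction.
Variable T : finType.
Implicit Types (G : {set {set T}}) (s : {perm T}) (t : tree T).

Definition relabel s G : {set {set T}} := [set s @: (e : {set T}) | e : {set T} in G].

(* A graph together with an optional cycle and an optional vertex, both absent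
   when empty. *)
Definition pointed_graph : finType := ({set {set T}} * {set {set T}} * {set T})%type.

Definition pg_act (w : pointed_graph) s : pointed_graph :=
  (relabel s w.1.1, relabel s w.1.2, s @: w.2).

Lemma relabel1 G : relabel 1 G = G.
Proof.
rewrite -[RHS]imset_id; apply: eq_imset => e.
by rewrite -[RHS]imset_id; apply: eq_imset => x; rewrite perm1.
Qed.

Lemma relabelM G s s' : relabel (s * s')%g G = relabel s' (relabel s G).
Proof.
rewrite /relabel -imset_comp; apply: eq_imset => e /=.
by rewrite -imset_comp; apply: eq_imset => x; rewrite /= permM.
Qed.

Lemma pg_act1 : pg_act^~ 1%g =1 id.
Proof.
case=> [[G C] V]; rewrite /pg_act /= !relabel1 -[in RHS](imset_id V).
by congr (_, _, _); apply: eq_imset => x; rewrite perm1.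
Qed.

Lemma pg_actM w : act_morph pg_act w.
Proof.
move=> s s'; case: w => [[G C] V]; rewrite /pg_act /= !relabelM -imset_comp.
by congr (_, _, _); apply: eq_imset => x; rewrite /= permM.
Qed.

Definition pg_action := TotalAction pg_act1 pg_actM.

Lemma square_relabel s x a b d :
  square (s x) (s a) (s b) (s d) = relabel s (square x a b d).
Proof. by rewrite /relabel /square !imsetU !imset_set1 /= !imsetU !imset_set1. Qed.

Lemma edges_tmap s t : edges (tmap s t) = relabel s (edges t).
Proof.
elim: t => [l|t IHt a IHa b IHb d IHd] /=; first by exact/esym/imset0.
by rewrite !root_tmap square_relabel IHt IHa IHb IHd [in RHS]/relabel 4!imsetU.
Qed.

Lemma qsquare_qmap s (p : quad T) : qsquare (qmap s p) = relabel s (qsquare p).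
Proof. by case: p => [[[t a] b] d] /=; rewrite !root_tmap square_relabel. Qed.

End GraphAction.

Definition full (T : finType) (p : quad T) := perm_eq (labels (nd p)) (enum T).

Section OrbitCount.
Variables (T : finType) (L : eqType) (col : T -> L).

Definition col_stab : {set {perm T}} := [set s : {perm T} | [forall i, col (s i) == col i]].

Lemma col_stabP (s : {perm T}) : reflect (col \o s =1 col) (s \in col_stab).
Proof. by rewrite inE; apply: (iffP forallP) => h i; apply/eqP; apply: h. Qed.

Lemma group_set_col_stab : group_set col_stab.
Proof.
apply/group_setP; split=> [|s s' /col_stabP h /col_stabP h']; apply/col_stabP => i /=.
  by rewrite perm1.
rewrite permM; exact: etrans (h' (s i)) (h i).
Qed.
Canonical col_stab_group := Group group_set_col_stab.

(** Equal coloured trees have equal shapes. The permutation sends each vertex of [t] to the vertex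
    of [u] in the same position, which has the same colour. *)
Lemma tmap_stab (t u : tree T) : perm_eq (labels t) (enum T) -> perm_eq (labels u) (enum T) ->
  tmap col t = tmap col u -> exists2 s : {perm T}, s \in col_stab & tmap s t = u.
Proof.
move=> ft fu e; have st : size (labels t) = size (labels u).
  by rewrite (perm_size ft) (perm_size fu).
have mt x : x \in labels t by rewrite (perm_mem ft) mem_enum.
have ut : uniq (labels t) by rewrite (perm_uniq ft) enum_uniq.
have uu : uniq (labels u) by rewrite (perm_uniq fu) enum_uniq.
pose f x := nth x (labels u) (index x (labels t)).
have fI : injective f.
  move=> x y; rewrite /f; have iy : index y (labels t) < size (labels u) by rewrite -st index_mem.
  have ix : index x (labels t) < size (labels u) by rewrite -st index_mem.
  rewrite (set_nth_default x y iy) => /eqP; rewrite nth_uniq // => /eqP ei.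
  by rewrite -(nth_index x (mt x)) -(nth_index x (mt y)) ei.
have lf : map f (labels t) = labels u.
  apply: (@eq_from_nth _ (root t)) => [|i]; rewrite size_map // => it.
  by rewrite (nth_map (root t)) // /f index_uniq //; apply: set_nth_default; rewrite -st.
have fs (v : tree T) : tmap (perm fI) v = tmap f v.
  by apply: eq_in_tmap => x _; rewrite permE.
exists (perm fI); last first.
  rewrite fs; apply: (@tmap_labels_inj _ _ col); last by rewrite labels_tmap.
  rewrite -e tmap_comp; apply: eq_in_tmap => x xt /=.
  have := congr1 (@labels _) e; rewrite !labels_tmap =>
    /(congr1 (nth (col x) ^~ (index x (labels t)))).
  by rewrite !(nth_map x) ?index_mem -?st ?index_mem // nth_index // => ->.
apply/col_stabP => x /=; rewrite permE.
have := congr1 (@labels _) e; rewrite !labels_tmap =>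
  /(congr1 (nth (col x) ^~ (index x (labels t)))).
by rewrite !(nth_map x) ?index_mem -?st ?index_mem // nth_index // => ->.
Qed.

Variables (K : choiceType) (lab : K -> seq L).
Variables (S : {set pointed_graph T}) (graph : quad T -> pointed_graph T) (ob : quad L -> K).
(** Polymorphic in the labels: the equivalence is matched with graphs at [T] and with objects at
    [L], and colouring leads from one to the other. *)
Variable eqv : forall M : Type, quad M -> quad M -> Prop.

Hypothesis eqv_qmap : forall M M' (f : M -> M') (p q : quad M),
  eqv p q -> eqv (qmap f p) (qmap f q).
Hypothesis eqv_lift : forall M M' (f : M -> M') (p : quad M) q,
  eqv (qmap f p) q -> exists2 p', eqv p p' & qmap f p' = q.
Hypothesis eqv_full : forall p q : quad T, eqv p q -> full p -> full q.
Hypothesis graph_eqv : forall p q, full p -> full q -> graph p = graph q <-> eqv p q.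
Hypothesis graph_qmap : forall (s : {perm T}) p, graph (qmap s p) = pg_act (graph p) s.
Hypothesis graph_full : forall p, full p -> graph p \in S.
Hypothesis graph_surj : forall w, w \in S -> exists2 p, full p & graph p = w.
Hypothesis ob_eqv : forall p q, ob p = ob q <-> eqv p q.
Hypothesis ob_surj : forall x, exists p, ob p = x.
Hypothesis ob_lab : forall p, perm_eq (lab (ob p)) (labels (nd p)).

Lemma qmap_comp L1 L2 L3 (g : L2 -> L3) (f : L1 -> L2) p : qmap g (qmap f p) = qmap (g \o f) p.
Proof. by case: p => [[[t a] b] d]; rewrite /qmap !tmap_comp. Qed.

Lemma full_qmap_perm (s : {perm T}) p : full p -> full (qmap s p).
Proof.
move=> fp; rewrite /full nd_qmap labels_tmap.
apply: uniq_perm; rewrite ?enum_uniq //.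
  by rewrite map_inj_uniq ?(perm_uniq fp) ?enum_uniq //; apply: perm_inj.
move=> x; rewrite mem_enum; apply/mapP; exists (s^-1%g x); last by rewrite permKV.
by rewrite (perm_mem fp) mem_enum.
Qed.

(** The orbit of [graph p] corresponds to [ob (qmap col p)]. If [p] and [p'] give the same object,
    the equivalence of their coloured images lifts to one between [p] and a full quad coloured like
    [p'], which a colour-preserving permutation carries to [p']. Conversely, any coloured quad can
    be filled with vertices of the right colours. *)
Lemma orbit_count :
  has_card (fun x => perm_eq (lab x) (map col (enum T)))
           #|orbit (@pg_action T) col_stab @: S|.
Proof.
pose orb w := orbit (@pg_action T) col_stab w.
pose I : finType := {o : {set pointed_graph T} | o \in orb @: S}.
have rep (o : I) : exists x, exists2 p, full p & val o = orb (graph p) /\ ob (qmap col p) = x.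
  have /imsetP[w wS ->] := valP o; have [p fp <-] := graph_surj wS.
  by exists (ob (qmap col p)), p.
have [f fP] := fin_all_exists rep.
have orbE p (s : {perm T}) : s \in col_stab -> orb (graph (qmap s p)) = orb (graph p).
  move=> sH; rewrite graph_qmap; apply/orbit_eqP/imsetP.
  by exists s.
have -> : #|orb @: S| = #|I| by rewrite card_sig; apply: eq_card.
apply: (@has_card_bij _ _ _ f) => [o o' eo|x].
  have [p fp [op fo]] := fP o; have [p' fp' [op' fo']] := fP o'.
  have /ob_eqv/eqv_lift[q pq] : ob (qmap col p) = ob (qmap col p') by rewrite fo eo fo'.
  have fq := eqv_full pq fp; move=> /(congr1 (@nd _)); rewrite !nd_qmap.
  case/(tmap_stab fq fp') => s sH sq; apply/val_inj; rewrite op op'.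
  have -> : p' = qmap s q.
    case: q p' sq {pq fq fp' op' fo'} => [[[t a] b] d] [[[t' a'] b'] d'] /=.
    by case=> -> -> -> ->.
  by rewrite orbE //; congr orb; apply/graph_eqv.
split=> [xl|[o <-]]; last first.
  have [p fp [_ <-]] := fP o; apply: perm_trans (ob_lab _) _.
  by rewrite nd_qmap labels_tmap perm_map.
have [u eu] := ob_surj x; have ul : perm_eq (labels (nd u)) (map col (enum T)).
  by rewrite perm_sym; apply: perm_trans (ob_lab u); rewrite eu perm_sym.
have [s se es] : exists2 s, perm_eq s (enum T) & map col s = labels (nd u).
  have /card_gt0P[y0 _] : 0 < #|T|.
    by rewrite cardT -(size_map col) -(perm_size ul) size_labels_gt0.
  have [Is pI ->] := perm_iotaP (col y0) ul.
  exists (map (nth y0 (enum T)) Is).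
    apply: perm_trans (perm_map _ pI) _.
    by rewrite size_map -/(mkseq _ _) mkseq_nth.
  rewrite -map_comp; apply/eq_in_map => i /=; rewrite (perm_mem pI) mem_iota size_map => iT.
  by rewrite (nth_map y0).
have [t tl] := tmap_fill es; case: t tl => [l|t a b d] tl.
  by case: u {eu ul es} => [[[]]].
move=> tu; pose p : quad T := (t, a, b, d).
have pu : qmap col p = u by case: u tu {eu ul es} => [[[t' a'] b'] d'] /= [<- <- <- <-].
have fp : full p by move: se; rewrite -tl.
have oI : orb (graph p) \in orb @: S by apply: imset_f; apply: graph_full.
pose o1 : I := exist (fun o => o \in orb @: S) _ oI; exists o1;
  have [p1 fp1 [/= op1 <-]] := fP o1.
(* The representative [p1] chosen for the orbit may differ from [p]; the permutation [s1] that joins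
   their graphs preserves colours and so does not change the object. *)
have /imsetP[s1 s1H] : graph p1 \in orb (graph p) by rewrite op1 orbit_refl.
rewrite /= -graph_qmap => /graph_eqv-/(_ fp1 (full_qmap_perm _ fp)) /(eqv_qmap col).
move/ob_eqv => ->; rewrite -eu -pu qmap_comp; congr ob.
have ct v : tmap (col \o s1) v = tmap col v.
  by apply: eq_in_tmap => z _; apply: (col_stabP _ s1H).
by rewrite /p /qmap !ct.
Qed.

End OrbitCount.

(** * Pointed cacti as full quads *)

Section FourCacti.
Variable T : finType.
Implicit Types (G C : {set {set T}}) (p q : quad T) (t u : tree T).

Lemma local_cactusP G : reflect (local_cactus G)
  [forall e in G, exists C : {set {set T}},
     ([set D in cycles G | e \in D] == [set C]) && (#|C| == 4)].
Proof.
apply: (iffP forall_inP) => cG e eG.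
  have /existsP[C /andP[/eqP/setP eC /eqP C4]] := cG e eG.
  have := eC C; rewrite in_set1 eqxx 1!inE => /andP[CG eC'].
  exists C; first by split. move=> D DG eD; have := eC D.
  by rewrite in_set1 1!inE DG eD => /esym/eqP.
have [C [CG eC C4] uC] := cG e eG; apply/existsP; exists C; rewrite C4 eqxx andbT.
apply/eqP/setP => D; rewrite in_set1 1!inE; apply/idP/eqP => [/andP[DG eD]|->]; first exact: uC.
by rewrite CG.
Qed.

Lemma cycle_neq0 G C : C \in cycles G -> exists e, e \in C.
Proof.
case/cyclesP=> c [+ _ ->]; case: c => // x c _; exists [set x; next (x :: c) x].
by apply: (imset_f (fun y => [set y; next (x :: c) y])); rewrite mem_head.
Qed.

Lemma local_cactus_cycle4 G C : local_cactus G -> C \in cycles G -> #|C| = 4.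
Proof.
move=> cG CG; have [e eC] := cycle_neq0 CG.
have [D [_ _ D4] uD] := cG e (subsetP (cycles_sub CG) e eC).
by rewrite (uD C).
Qed.

(** Four trees with 3c_i + 1 vertices each, joined around one new cycle, have 3(c_1 + ... + c_4 + 1)
    + 1 vertices together. The sets of cycles are disjoint because the pieces share no edge. *)
Lemma card_cycles t : uniq (labels t) -> size (labels t) = 3 * #|cycles (edges t)| + 1.
Proof.
elim: t => [l _|t IHt a IHa b IHb d IHd u] /=.
  suff -> : cycles (set0 : {set {set T}}) = set0 by rewrite cards0.
  apply/setP => C; rewrite [RHS]inE; apply/negP => CG; have [e eC] := cycle_neq0 CG.
  by have := subsetP (cycles_sub CG) e eC; rewrite inE.
have [[ut ua ub ud] [[t_a t_b t_d] [a_b a_d b_d]]] := uniq_NdP u.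
pose S := square (root t) (root a) (root b) (root d).
have eqc : cycles (edges (Nd t a b d)) = S |: cycles (edges t) :|: cycles (edges a)
    :|: cycles (edges b) :|: cycles (edges d).
  apply/setP => C; rewrite cycles_Nd // 4!in_setU in_set1 -!orbA; congr [|| _, _, _, _ | _].
have dis v w C : apart v w -> uniq (labels v) -> C \in cycles (edges v) ->
  C \in cycles (edges w) -> False.
  move=> vw uv Cv Cw; have [e eC] := cycle_neq0 Cv.
  have ev := subsetP (cycles_sub Cv) e eC; have ew := subsetP (cycles_sub Cw) e eC.
  have /card_gt0P[z ze] : 0 < #|e| by rewrite (edges_card2 uv ev).
  by apply: (vw z); apply: cover_edges; apply/bigcupP; exists e.
have disS v : edges v \subset edges t :|: edges a :|: edges b :|: edges d ->
  S \in cycles (edges v) -> False.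
  move=> vs Sv; have [e eS] := cycle_neq0 Sv.
  have := edges_squareD u (subsetP vs e (subsetP (cycles_sub Sv) e eS)).
  by rewrite eS.
have cU (A B : {set {set {set T}}}) : (forall C, C \in A -> C \in B -> False) ->
  #|A :|: B| = #|A| + #|B|.
  move=> AB; apply/eqP; rewrite (leq_card_setU A B); apply/pred0P => C /=.
  by apply/negP => /andP[CA CB]; apply: (AB C).
move: eqc => /= ->; rewrite !cU ?cards1 ?size_cat ?IHt ?IHa ?IHb ?IHd //.
- by lia.
- by move=> C; rewrite in_set1 => /eqP->; apply: disS; rewrite -!setUA subsetUl.
- move=> C; rewrite in_setU in_set1 => /orP[/eqP->|Ct Ca]; last exact: dis t_a ut Ct Ca.
  by apply: disS; apply/subsetP => e; rewrite !in_setU => ->; rewrite ?orbT.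
- move=> C; rewrite 2!in_setU in_set1 => /orP[/orP[/eqP->|Ct Ca]|Ca Cb].
  + by apply: disS; apply/subsetP => e; rewrite !in_setU => ->; rewrite ?orbT.
  + exact: dis t_b ut Ct Ca.
  + exact: dis a_b ua Ca Cb.
- move=> C; rewrite 3!in_setU in_set1 => /orP[/orP[/orP[/eqP->|Ct Ca]|Ca Cb]|Ca Cb].
  + by apply: disS; apply/subsetP => e; rewrite !in_setU => ->; rewrite ?orbT.
  + exact: dis t_d ut Ct Ca.
  + exact: dis a_d ua Ca Cb.
  + exact: dis b_d ub Ca Cb.
Qed.

Definition cacti : {set {set {set T}}} := [set G | (3 <= #|T|) && four_cactus G].

Lemma full_cactus p : full p ->
  [/\ edges (nd p) \in cacti, qsquare p \in cycles (edges (nd p)) & root (nd p) \in cover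
    (qsquare p)].
Proof.
case: p => [[[t a] b] d] fp; have u : uniq (labels (Nd t a b d)).
  by rewrite (perm_uniq fp) enum_uniq.
have ml x : x \in labels (Nd t a b d) by rewrite (perm_mem fp) mem_enum.
split; [|by rewrite cycles_Nd // eqxx|by rewrite cover_square !inE eqxx].
rewrite inE; apply/and4P; split.
- have := perm_size fp; rewrite -cardE => <- /=; rewrite !size_cat.
  have := (size_labels_gt0 t, size_labels_gt0 a, size_labels_gt0 b); case=> [[]]; lia.
- by apply/forall_inP => e /(edges_card2 u) ->.
- rewrite /connected_graph; apply/andP; split; first by apply/card_gt0P; exists (root t).
  apply/forallP => x; apply/forallP => y.
  apply: connect_trans (connect_edges (ml y)); rewrite connectC; exact: connect_edges (ml x).
- by apply/local_cactusP; apply: edges_local_cactus.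
Qed.

Lemma cacti_local G : G \in cacti -> local_cactus G.
Proof. by rewrite inE => /and4P[_ _ _ /local_cactusP]. Qed.

Lemma cacti_connect G x y : G \in cacti -> connect (adj G) x y.
Proof. by rewrite inE => /and4P[_ _ /andP[_ /forallP/(_ x)/forallP/(_ y)]]. Qed.

(** The lower bound on the number of vertices excludes the single vertex, which has no cycle;
    connectedness then gives [v] an edge. *)
Lemma cacti_vertex_cycle G v : G \in cacti -> exists2 C, C \in cycles G & v \in cover C.
Proof.
move=> cG; have [w wv] : exists w, w != v.
  have : 0 < #|[set~ v]| by rewrite cardsC1; move: cG; rewrite inE => /andP[]; lia.
  by case/card_gt0P=> w; rewrite !inE; exists w.
have /connectP[[|y p] /= vp ew] := cacti_connect v w cG; first by rewrite ew eqxx in wv.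
case/andP: vp => vy _; have [C [CG eC _] _] := cacti_local cG vy.
by exists C => //; apply/bigcupP; exists [set v; y]; rewrite ?set21.
Qed.

(** By connectedness, the component described by the tree built around [C] is all of [G]. *)
Lemma cactus_quad G C v : G \in cacti -> C \in cycles G -> v \in cover C ->
  exists p, [/\ full p, edges (nd p) = G, qsquare p = C & root (nd p) = v].
Proof.
move=> cG CG vC; have lG := cacti_local cG.
have [w|t [a [b [d [rt u sq [sub clos]]]]]] := fill_cycle lG CG (local_cactus_cycle4 lG CG) vC.
  exact: (fill_exists w (local_cactusD lG CG)).
have ml x : x \in labels (Nd t a b d).
  have /connectP[p vp ->] := cacti_connect v x cG.
  have vl : v \in labels (Nd t a b d) by rewrite -rt; apply: (mem_root (Nd t a b d)).
  elim: p v vl vp {vC rt} => [//|y p IH] z zl /andP[zy yp]; apply: (IH y) yp.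
  apply: cover_edges; apply: (@adj_cover _ _ y z); rewrite adjC; exact: clos.
exists (t, a, b, d); split=> //.
  by apply: uniq_perm; rewrite ?enum_uniq // => x; rewrite mem_enum; apply: ml.
apply/eqP; rewrite eqEsubset sub /=; apply/subsetP => e eG.
have e2 : #|e| == 2 by move: cG; rewrite inE => /and4P[_ /forall_inP/(_ e eG)].
case/cards2P: e2 eG => x [y [_ ->]] eG; exact: clos.
Qed.

Definition vertex_graph p : pointed_graph T := (edges (nd p), set0, [set root (nd p)]).
Definition flag_graph p : pointed_graph T := (edges (nd p), qsquare p, [set root (nd p)]).
Definition cycle_graph p : pointed_graph T := (edges (nd p), qsquare p, set0).

Definition cactus_graphs : {set pointed_graph T} :=
  [set w : pointed_graph T | [&& w.1.1 \in cacti, w.1.2 == set0 & w.2 == set0]].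
Definition cactus_vertices : {set pointed_graph T} :=
  [set w : pointed_graph T | [&& w.1.1 \in cacti, w.1.2 == set0 & #|w.2| == 1]].
Definition cactus_cycles : {set pointed_graph T} :=
  [set w : pointed_graph T | [&& w.1.1 \in cacti, w.1.2 \in cycles w.1.1 & w.2 == set0]].
Definition cactus_flags : {set pointed_graph T} :=
  [set w : pointed_graph T | [&& w.1.1 \in cacti, w.1.2 \in cycles w.1.1, #|w.2| == 1 & w.2
    \subset cover w.1.2]].

Lemma vertex_graph_full p : full p -> vertex_graph p \in cactus_vertices.
Proof. by case/full_cactus=> cp _ _; rewrite inE /= cp cards1 !eqxx. Qed.

Lemma cycle_graph_full p : full p -> cycle_graph p \in cactus_cycles.
Proof. by case/full_cactus=> cp sp _; rewrite inE /= cp sp !eqxx. Qed.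

Lemma flag_graph_full p : full p -> flag_graph p \in cactus_flags.
Proof. by case/full_cactus=> cp sp rp; rewrite inE /= cp sp cards1 sub1set rp. Qed.

Lemma flag_graph_surj w : w \in cactus_flags -> exists2 p, full p & flag_graph p = w.
Proof.
case: w => [[G C] V]; rewrite inE /= => /and4P[cG CG /cards1P[v ->]]; rewrite sub1set => vC.
by have [p [fp <- <- <-]] := cactus_quad cG CG vC; exists p.
Qed.

Lemma vertex_graph_surj w : w \in cactus_vertices -> exists2 p, full p & vertex_graph p = w.
Proof.
case: w => [[G C] V]; rewrite inE /= => /and3P[cG /eqP-> /cards1P[v ->]].
have [C' CG vC] := cacti_vertex_cycle v cG.
by have [p [fp <- _ <-]] := cactus_quad cG CG vC; exists p.
Qed.

Lemma cycle_cover_neq0 G C : C \in cycles G -> exists v, v \in cover C.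
Proof.
case/cyclesP=> c [+ _ ->]; case: c => // x c _; exists x.
by rewrite cover_cycle_edges inE mem_head.
Qed.

Lemma cycle_graph_surj w : w \in cactus_cycles -> exists2 p, full p & cycle_graph p = w.
Proof.
case: w => [[G C] V]; rewrite inE /= => /and3P[cG CG /eqP->].
have [v vC] := cycle_cover_neq0 CG.
by have [p [fp <- <- _]] := cactus_quad cG CG vC; exists p.
Qed.

Lemma full_uniq p : full p -> uniq (labels (nd p)).
Proof. by move=> fp; rewrite (perm_uniq fp) enum_uniq. Qed.

Lemma vertex_graph_eqP p q : full p -> full q ->
  vertex_graph p = vertex_graph q <-> vertex_eq p q.
Proof.
move=> fp fq; split=> [[ee /set1_inj er]|pq]; first by apply: edges_inj; rewrite ?full_uniq.
by rewrite /vertex_graph (edges_teq pq) (root_teq pq).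
Qed.

Lemma flag_graph_eqP p q : full p -> full q -> flag_graph p = flag_graph q <-> flag_eq p q.
Proof.
move=> fp fq; split=> [[ee es /set1_inj er]|/flag_eq_graph[ee es er]].
  by apply: flag_eqP; rewrite ?full_uniq.
by rewrite /flag_graph ee es er.
Qed.

Lemma cycle_graph_eqP p q : full p -> full q -> cycle_graph p = cycle_graph q <-> cycle_eq p q.
Proof.
move=> fp fq; split=> [[ee es]|/cycle_eq_graph[ee es]].
  by apply: cycle_eqP; rewrite ?full_uniq.
by rewrite /cycle_graph ee es.
Qed.

Lemma vertex_graph_qmap (s : {perm T}) p : vertex_graph (qmap s p) = pg_act (vertex_graph p) s.
Proof.
rewrite /vertex_graph /pg_act /= nd_qmap edges_tmap root_tmap imset_set1.
by congr (_, _, _); rewrite /relabel imset0.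
Qed.

Lemma flag_graph_qmap (s : {perm T}) p : flag_graph (qmap s p) = pg_act (flag_graph p) s.
Proof. by rewrite /flag_graph /pg_act /= nd_qmap edges_tmap root_tmap imset_set1 qsquare_qmap.
  Qed.

Lemma cycle_graph_qmap (s : {perm T}) p : cycle_graph (qmap s p) = pg_act (cycle_graph p) s.
Proof. by rewrite /cycle_graph /pg_act /= nd_qmap edges_tmap imset0 qsquare_qmap. Qed.

End FourCacti.

(** * Dissymmetry *)

Section FixedPoints.
Import GRing.Theory Num.Theory.

Lemma enum_set_ord (W : finType) (A : {set W}) n : #|A| = n ->
  exists a : 'I_n -> W, [/\ injective a, forall x, x \in A <-> exists i, a i = x &
    forall F : W -> rat, (\sum_i F (a i) = \sum_(x in A) F x)%R].
Proof.
move=> <-; exists enum_val; split; first exact: enum_val_inj.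
  move=> x; split=> [xA|[i <-]]; last exact: enum_valP.
  by exists (enum_rank_in xA x); rewrite enum_rankK_in.
by move=> F; rewrite -big_enum_val.
Qed.

(* The matrix [m], with rows in [B] and columns in [A], conjugates the two
   permutation matrices of [f], so these have the same trace. *)
Lemma card_fix_eq (W : finType) (A B : {set W}) (f : W -> W) (m : W -> W -> rat) :
  injective f -> (forall x, x \in A -> f x \in A) -> (forall x, x \in B -> f x \in B) ->
  #|A| = #|B| ->
  (forall e v, m (f e) (f v) = m e v) ->
  (forall x : W -> rat, (forall e, e \in B -> (\sum_(v in A) m e v * x v)%R = 0%R) ->
     forall v, v \in A -> x v = 0%R) ->
  #|[set v in A | f v == v]| = #|[set e in B | f e == e]|.
Proof.
move=> fI fA fB AB mf ker.
have [a [aI aA aS]] := enum_set_ord (erefl #|A|).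
have [b [bI bB bS]] := enum_set_ord (esym AB).
have Ba i : a i \in A by apply/aA; exists i.
have Bb i : b i \in B by apply/bB; exists i.
pose M : 'M[rat]_#|A| := (\matrix_(i, j) m (b i) (a j))%R.
pose PA : 'M[rat]_#|A| := (\matrix_(i, j) (f (a i) == a j)%:R)%R.
pose PB : 'M[rat]_#|A| := (\matrix_(i, j) (f (b i) == b j)%:R)%R.
have Mu : M \in unitmx.
  (* [inj_row_free] concerns the left kernel, the hypothesis the right one; hence the transpose. *)
  rewrite -unitmx_tr -row_free_unit; apply: inj_row_free => x xM.
  pose y v := (\sum_i (a i == v)%:R * x 0 i)%R.
  have ya j : y (a j) = x 0%R j.
    rewrite /y (bigD1 j) //= eqxx mul1r big1 ?addr0 // => i ij.
    by rewrite (inj_eq aI) (negbTE ij) mul0r.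
  apply/rowP => j; rewrite [RHS]mxE -ya; apply: ker => // e /bB[i <-].
  rewrite -aS; have /rowP/(_ i) := xM; rewrite !mxE => xMi; rewrite -[RHS]xMi;
    apply: eq_bigr => k _.
  by rewrite ya !mxE mulrC.
have e1 : (PB *m M = M *m PA)%R.
  apply/matrixP => i j; rewrite !mxE.
  have -> : (\sum_k PB i k * M k j = \sum_(e in B) (f (b i) == e)%:R * m e (a j))%R.
    by rewrite -bS; apply: eq_bigr => k _; rewrite !mxE.
  have -> : (\sum_k M i k * PA k j = \sum_(v in A) m (b i) v * (f v == a j)%:R)%R.
    by rewrite -aS; apply: eq_bigr => k _; rewrite !mxE.
  rewrite (bigD1 (f (b i))) ?fB //= eqxx mul1r big1 ?addr0 => [|e /andP[_ ne]]; last first.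
    by rewrite eq_sym (negbTE ne) mul0r.
  have [v vA fv] : exists2 v, v \in A & f v = a j.
    have fAA : f @: A = A.
      apply/eqP; rewrite eqEcard card_imset // leqnn andbT.
      by apply/subsetP => _ /imsetP[v vA ->]; apply: fA.
    by have := Ba j; rewrite -{1}fAA => /imsetP[v vA ->]; exists v.
  rewrite (bigD1 v) //= fv eqxx mulr1 big1 ?addr0 => [|u /andP[_ nu]]; last first.
    by rewrite -fv (inj_eq fI) (negbTE nu) mulr0.
  by rewrite -fv mf.
have tr : (\tr PB = \tr PA)%R.
  have -> : PB = (M *m PA *m invmx M)%R by rewrite -e1 mulmxK.
  by rewrite mxtrace_mulC mulmxA mulVmx // mul1mx.
have fixE (D : {set W}) : (#|[set v in D | f v == v]|%:R = \sum_(v in D) (f v == v)%:R :> rat)%R.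
  rewrite -sum1_card natr_sum (eq_bigl (fun v => (v \in D) && (f v == v))) => [|v];
    last by rewrite inE.
  by rewrite big_mkcondr; apply: eq_bigr => v _; case: eqP.
apply/eqP; rewrite -(eqr_nat rat) !fixE -aS -bS; apply/eqP.
rewrite -[LHS](_ : \tr PA = _)%R; last by apply: eq_bigr => i _; rewrite mxE.
by rewrite -tr; apply: eq_bigr => i _; rewrite mxE.
Qed.

End FixedPoints.

Section Dissymmetry.
Import GRing.Theory Num.Theory.
Variable T : finType.
Implicit Types (G C : {set {set T}}) (w : pointed_graph T).
Notation to := (pg_action T).

Lemma in_graphs G C V :
  ((G, C, V) \in cactus_graphs T) = [&& G \in cacti T, C == set0 & V == set0].
Proof. by rewrite in_set. Qed.

Lemma in_vertices G C V :
  ((G, C, V) \in cactus_vertices T) = [&& G \in cacti T, C == set0 & #|V| == 1].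
Proof. by rewrite in_set. Qed.

Lemma in_cycles G C V :
  ((G, C, V) \in cactus_cycles T) = [&& G \in cacti T, C \in cycles G & V == set0].
Proof. by rewrite in_set. Qed.

Lemma in_flags G C V : ((G, C, V) \in cactus_flags T) =
  [&& G \in cacti T, C \in cycles G, #|V| == 1 & V \subset cover C].
Proof. by rewrite in_set. Qed.

(** A relabelled full quad is full; this spares the transport of connectedness and cycles along
    [s]. *)
Lemma act_vertices w (s : {perm T}) : w \in cactus_vertices T -> pg_act w s \in cactus_vertices T.
Proof.
case/vertex_graph_surj=> p fp <-; rewrite -vertex_graph_qmap.
exact/vertex_graph_full/full_qmap_perm.
Qed.

Lemma act_cycles w (s : {perm T}) : w \in cactus_cycles T -> pg_act w s \in cactus_cycles T.
Proof.
case/cycle_graph_surj=> p fp <-; rewrite -cycle_graph_qmap.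
exact/cycle_graph_full/full_qmap_perm.
Qed.

Lemma act_flags w (s : {perm T}) : w \in cactus_flags T -> pg_act w s \in cactus_flags T.
Proof.
case/flag_graph_surj=> p fp <-; rewrite -flag_graph_qmap.
exact/flag_graph_full/full_qmap_perm.
Qed.

Lemma cacti_vertex G : G \in cacti T -> exists v : T, true.
Proof. by rewrite inE => /andP[T3 _]; have /card_gt0P[v _] : 0 < #|T| by lia; exists v. Qed.

Lemma relabel_cacti G (s : {perm T}) : G \in cacti T -> relabel s G \in cacti T.
Proof.
move=> cG; have [v _] := cacti_vertex cG.
have : pg_act (G, set0, [set v]) s \in cactus_vertices T.
  by apply: act_vertices; rewrite inE /= cG cards1 !eqxx.
by rewrite inE => /and3P[].
Qed.

Lemma act_graphs w (s : {perm T}) : w \in cactus_graphs T -> pg_act w s \in cactus_graphs T.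
Proof.
case: w => [[G C] V]; rewrite in_graphs => /and3P[cG /eqP-> /eqP->].
by rewrite in_graphs relabel_cacti //= /relabel !imset0 !eqxx.
Qed.

Lemma cacti_size G : G \in cacti T -> #|T| = 3 * #|cycles G| + 1.
Proof.
move=> cG; have [v _] := cacti_vertex cG; have [C CG vC] := cacti_vertex_cycle v cG.
have [p [fp <- _ _]] := cactus_quad cG CG vC.
by rewrite -card_cycles ?full_uniq // (perm_size fp) -cardE.
Qed.

Lemma card_cover_cycle G C : G \in cacti T -> C \in cycles G -> #|cover C| = 4.
Proof.
move=> cG CG; have [v vC] := cycle_cover_neq0 CG.
have [a [b [d [u ->]]]] := cycle_card4 CG (local_cactus_cycle4 (cacti_local cG) CG) vC.
by rewrite cover_square cardsE; apply/card_uniqP.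
Qed.

Lemma cycle_set0 G : (set0 \in cycles G) = false.
Proof. by apply/negP => /cycle_neq0[e]; rewrite inE. Qed.

Lemma card_vertices : #|cactus_vertices T| = #|cacti T| * #|T|.
Proof.
have -> : cactus_vertices T = [set (x.1, set0, [set x.2]) | x in setX (cacti T) [set: T]].
  apply/setP => -[[G C] V]; rewrite in_vertices; apply/and3P/imsetP.
    by case=> cG /eqP-> /cards1P[v ->]; exists (G, v); rewrite // in_setX cG inE.
  by case=> -[G' v] /setXP[/= cG _] [-> -> ->]; rewrite cards1.
by rewrite card_imset ?cardsX ?cardsT // => -[G v] [G' v'] [-> /set1_inj->].
Qed.

Lemma cactus_graphsE : cactus_graphs T = [set (G, set0, set0) | G in cacti T].
Proof.
apply/setP => -[[G C] V]; rewrite in_graphs; apply/and3P/imsetP.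
  by case=> cG /eqP-> /eqP->; exists G.
by case=> G' cG [-> -> ->].
Qed.

Lemma card_graphs : #|cactus_graphs T| = #|cacti T|.
Proof. by rewrite cactus_graphsE card_imset // => G G' []. Qed.

Lemma card_cactus_cycles : #|cactus_cycles T| = \sum_(G in cacti T) #|cycles G|.
Proof.
rewrite -sum1_card (partition_big (fun w => w.1.1) (mem (cacti T))) /= => [|[[G C] V]];
  last first.
  by rewrite in_cycles => /and3P[].
apply: eq_bigr => G cG.
have injf : injective (fun C : {set {set T}} => (G, C, set0) : pointed_graph T).
  by move=> C C' [].
rewrite sum1_card -(card_imset (cycles G) injf).
  apply: eq_card => -[[G' C] V]; rewrite unfold_in [_ && _]/= in_cycles.
  apply/andP/imsetP => [[/and3P[_ CG /eqP->] /eqP e]|[C' CG [-> -> ->]]].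
    by move: CG; rewrite /= in e *; rewrite e => CG; exists C.
  by rewrite cG CG !eqxx.
Qed.

Lemma card_flags : #|cactus_flags T| = #|cactus_cycles T| * 4.
Proof.
rewrite -sum1_card (partition_big (fun w => (w.1, set0)) (mem (cactus_cycles T))) /= =>
  [|[[G C] V]].
  rewrite -sum_nat_const; apply: eq_bigr => -[[G C] V]; rewrite in_cycles => /and3P[cG CG /eqP->].
  have injf : injective (fun v : T => (G, C, [set v]) : pointed_graph T).
    by move=> v v' [] /set1_inj.
  rewrite -(card_cover_cycle cG CG) sum1_card -(card_imset (cover C) injf).
  apply: eq_card => -[[G' C'] V']; rewrite unfold_in [_ && _]/= in_flags.
  apply/andP/imsetP => [[/and4P[_ _ /cards1P[v ->] vC] /eqP[e1 e2]]|[v vC [-> -> ->]]].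
    by exists v; rewrite ?e1 ?e2 // -sub1set -e2.
  by rewrite cG CG cards1 !eqxx sub1set.
by rewrite in_flags in_cycles => /and4P[-> -> _ _]; rewrite eqxx.
Qed.

Lemma vertices_cycles_disjoint : cactus_vertices T :&: cactus_cycles T = set0.
Proof.
apply/setP => -[[G C] V]; rewrite in_setI in_vertices in_cycles in_set0.
by apply/negP => /andP[/and3P[_ /eqP-> _]]; rewrite cycle_set0 /= andbF.
Qed.

Lemma flags_graphs_disjoint : cactus_flags T :&: cactus_graphs T = set0.
Proof.
apply/setP => -[[G C] V]; rewrite in_setI in_flags in_graphs in_set0.
by apply/negP => /andP[/and4P[_ CG _ _] /and3P[_ /eqP C0 _]]; rewrite C0 cycle_set0 in CG.
Qed.

(** For each cactus with c cycles, (3c + 1) + c = 4c + 1. *)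
Lemma card_incidence :
  #|cactus_vertices T :|: cactus_cycles T| = #|cactus_flags T :|: cactus_graphs T|.
Proof.
rewrite !cardsU vertices_cycles_disjoint flags_graphs_disjoint !cards0 !subn0 card_vertices
  card_graphs card_flags card_cactus_cycles.
have -> : #|cacti T| * #|T| = \sum_(G in cacti T) (3 * #|cycles G| + 1).
  by rewrite -sum_nat_const; apply: eq_bigr => G; apply: cacti_size.
rewrite big_split /= -big_distrr /= sum1_card.
move: (\sum_(G in _) _) #|cacti T| => k c; lia.
Qed.

(* Rows: [x - y] for a flag made of the vertex [x] and the cycle [y], and the sum
   over all vertices and cycles for a cactus. *)
Definition incidence (e v : pointed_graph T) : rat :=
  (if e.1.1 != v.1.1 then 0
   else if e.1.2 == set0 then 1
   else (v == (e.1.1, set0, e.2))%:R - (v == (e.1, set0))%:R)%R.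

Lemma relabel_inj (s : {perm T}) : injective (@relabel T s).
Proof. by apply: imset_inj; apply: imset_inj; apply: perm_inj. Qed.

Lemma pg_act_inj (s : {perm T}) : injective (@pg_act T ^~ s).
Proof.
by move=> [[G C] V] [[G' C'] V'] [/relabel_inj-> /relabel_inj->] /(imset_inj (@perm_inj _ s))->.
Qed.

Lemma incidence_act (s : {perm T}) e v : incidence (pg_act e s) (pg_act v s) = incidence e v.
Proof.
rewrite /incidence /= (inj_eq (@relabel_inj s)) imset_eq0.
have -> : (relabel s e.1.1, set0, s @: e.2) = pg_act (e.1.1, set0, e.2) s.
  by rewrite /pg_act /relabel imset0.
have -> : (relabel s e.1.1, relabel s e.1.2, set0) = pg_act (e.1, set0) s.
  by rewrite /pg_act imset0.
by rewrite !(inj_eq (@pg_act_inj s)).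
Qed.

(** The flag rows make [x] agree on a cycle and its vertices, so by connectedness [x] is constant on
    each cactus. The row of ones says that a positive multiple of this constant vanishes. Entries
    between different graphs are zero, so the cacti do not interact. *)
Lemma incidence_inj (x : pointed_graph T -> rat) :
  (forall e, e \in cactus_flags T :|: cactus_graphs T ->
     (\sum_(v in cactus_vertices T :|: cactus_cycles T) incidence e v * x v = 0)%R) ->
  forall v, v \in cactus_vertices T :|: cactus_cycles T -> x v = 0%R.
Proof.
move=> ker; have flagE G C v : G \in cacti T -> C \in cycles G -> v \in cover C ->
    x (G, set0, [set v]) = x (G, C, set0).
  move=> cG CG vC; have := ker (G, C, [set v]).
  rewrite in_setU in_flags cG CG cards1 eqxx sub1set vC => /(_ isT).
  have C0 : (C == set0) = false by apply: contraTF CG => /eqP->; rewrite cycle_set0.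
  have A1 : (G, set0, [set v]) \in cactus_vertices T :|: cactus_cycles T.
    by rewrite in_setU in_vertices cG cards1 !eqxx.
  have A2 : (G, C, set0) \in cactus_vertices T :|: cactus_cycles T.
    by rewrite in_setU in_cycles cG CG !eqxx orbT.
  have ne : (G, C, set0) != (G, set0, [set v]) :> pointed_graph T by rewrite !xpair_eqE C0 andbF.
  rewrite (bigD1 _ A1) /= (bigD1 (G, C, set0)) /=; last by apply/andP; split.
  rewrite big1 ?addr0.
    rewrite /incidence /= !eqxx /= C0 (negbTE ne) eq_sym (negbTE ne) /= mulr0n mulr1n subr0
      sub0r mul1r mulN1r.
    by move/eqP; rewrite subr_eq0 => /eqP.
  move=> w /andP[/andP[_ w1] w2]; rewrite /incidence /= C0 (negbTE w1) (negbTE w2) subrr.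
  by rewrite if_same mul0r.
have conn G (v w : T) : G \in cacti T -> x (G, set0, [set v]) = x (G, set0, [set w]).
  move=> cG; have /connectP[p vp ->] := cacti_connect v w cG.
  elim: p v vp => //= y p IH v /andP[vy yp]; rewrite -IH //.
  have [C [CG eC _] _] := cacti_local cG vy.
  rewrite (flagE G C v) // ?(flagE G C y) //; apply/bigcupP; exists [set v; y];
    rewrite ?set21 ?set22 //.
move=> u uA; have uG : u.1.1 \in cacti T.
  by case: u uA => [[G C] V]; rewrite in_setU in_vertices in_cycles => /orP[]/andP[].
have cst w : w \in cactus_vertices T :|: cactus_cycles T -> w.1.1 = u.1.1 -> x w = x u.
  have [v0 _] := cacti_vertex uG.
  have all w' : w' \in cactus_vertices T :|: cactus_cycles T -> w'.1.1 = u.1.1 ->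
      x w' = x (u.1.1, set0, [set v0]).
    case: w' => [[G C] V]; rewrite in_setU in_vertices in_cycles => + /= e; rewrite e.
    case/orP=> /and3P[_].
      by move=> /eqP-> /cards1P[v ->]; apply: conn.
    move=> CG /eqP->; have [v vC] := cycle_cover_neq0 CG.
    by rewrite -(flagE _ _ v) //; apply: conn.
  by move=> wA e; rewrite all // [RHS]all.
have := ker (u.1.1, set0, set0); rewrite in_setU in_graphs uG !eqxx orbT => /(_ isT).
rewrite (bigID (fun w => w.1.1 == u.1.1)) /= [X in (_ + X)%R]big1 ?addr0; last first.
  by move=> w /andP[_ ne]; rewrite /incidence /= eq_sym ne mul0r.
rewrite (eq_bigr (fun=> x u)) => [|w /andP[wA /eqP e]]; last first.
  by rewrite /incidence /= e !eqxx /= mul1r cst.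
rewrite sumr_const => /eqP; rewrite mulrn_eq0 => /orP[/eqP c0|/eqP//].
by have := card0_eq c0 u; rewrite unfold_in /= uA eqxx.
Qed.

Lemma dissymmetry (H : {group {perm T}}) :
  #|orbit to H @: cactus_vertices T| + #|orbit to H @: cactus_cycles T| =
  #|orbit to H @: cactus_flags T| + #|orbit to H @: cactus_graphs T|.
Proof.
have acts (S : {set pointed_graph T}) : (forall w (s : {perm T}), w \in S -> pg_act w s \in S) ->
    [acts H, on S | to].
  move=> Ss; apply/subsetP => s _; rewrite !inE; apply/subsetP => w wS; rewrite inE; exact: Ss.
have Hgt : 0 < #|H| by apply: cardG_gt0.
apply/eqP; rewrite -(eqn_pmul2r Hgt) !mulnDl; apply/eqP.
rewrite -!Frobenius_Cauchy;
  try by [apply: acts act_graphs|apply: acts act_flags|apply: acts act_cycles|apply: acts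
    act_vertices].
rewrite -!big_split /=; apply: eq_bigr => s _.
(* The two kinds on each side are disjoint, so their fixed points add up to those on the union that
   indexes the matrix. *)
have fixE (S S' : {set pointed_graph T}) : S :&: S' = set0 ->
    #|('Fix_(S | to)[s])%g| + #|('Fix_(S' | to)[s])%g| = #|[set w in S :|: S' | pg_act w s == w]|.
  move=> SS'; rewrite -[RHS]addn0 -(cards0 (pointed_graph T)).
  have <- : ('Fix_(S | to)[s])%g :&: ('Fix_(S' | to)[s])%g = set0.
    by apply/eqP; rewrite -subset0 -SS' setISS // subsetIl.
  rewrite -cardsUI; congr (_ + _); apply: eq_card => w.
  have -> : w \in ('Fix_(S | to)[s])%g :|: ('Fix_(S' | to)[s])%g = (w \in S :|: S') &&
    (w \in ('Fix_to[s])%g).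
    by rewrite in_setU !in_setI -andb_orl in_setU.
  by rewrite [RHS]inE; congr (_ && _); apply/afix1P/eqP.
rewrite !fixE ?vertices_cycles_disjoint ?flags_graphs_disjoint //.
apply: (@card_fix_eq _ _ _ (@pg_act T ^~ s) incidence).
- exact: pg_act_inj.
- by move=> w; rewrite !in_setU => /orP[/act_vertices|/act_cycles] ->; rewrite ?orbT.
- by move=> w; rewrite !in_setU => /orP[/act_flags|/act_graphs] ->; rewrite ?orbT.
- exact: card_incidence.
- by move=> e v; apply: incidence_act.
- exact: incidence_inj.
Qed.

End Dissymmetry.

(** * Objects of a specification *)

Section SpecConstructors.
Variable L : choiceType.
Implicit Types A B D : cclass L.

Lemma flatten_seq_mset A (s : seq A) :
  perm_eq (flatten [seq atoms a | a <- seq_mset s]) (flatten [seq atoms a | a <- s]).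
Proof. exact/Existence.perm_flatten_map2/perm_eq_seq_mset. Qed.

(** A solution provides only isomorphisms. From them, this lemma and the next two extract
    constructors, described by their atoms, surjectivity and equality rule. *)
Lemma ciso_pair A B : ciso A (cset_eq 2 B) -> exists pair : B -> B -> A,
  [/\ forall x y, perm_eq (atoms (pair x y)) (atoms x ++ atoms y),
      forall a, exists x y, pair x y = a &
      forall x y x' y', pair x y = pair x' y' <-> (x = x' /\ y = y') \/ (x = y' /\ y = x')].
Proof.
case=> f [g fK gK] fa.
have pf (x y : B) : size (seq_mset [:: x; y] : {mset B}%mset) == 2.
  by rewrite Existence.size_canon.
pose mk (x y : B) : cset_eq 2 B := exist (fun M : {mset B}%mset =>
  size M == 2) (seq_mset [:: x; y]) (pf x y).
exists (fun x y => g (mk x y)); split.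
- move=> x y; rewrite perm_sym; apply: perm_trans (fa _); rewrite gK perm_sym.
  by apply: perm_trans (flatten_seq_mset _) _; rewrite /= cats0.
- move=> a; case ea: (f a) => [M M2].
  have [x [y exy]] : exists x y, enum_mset M = [:: x; y].
    by have := M2; case: (enum_mset M) => [//|x [//|y []//]] _; exists x, y.
  exists x, y; rewrite -(fK a) ea; congr g; apply/val_inj => /=.
  by rewrite -exy seq_mset_id.
move=> x y x' y'; split=> [/(can_inj gK)/(congr1 val)/= /eq_seq_msetP e|e]; last first.
  congr g; apply/val_inj/eq_seq_msetP; case: e => -[-> ->] //.
  by apply/seq.permP => P /=; lia.
have : x \in [:: x'; y'] by rewrite -(perm_mem e) mem_head.
rewrite !inE => /orP[]/eqP ex; subst x.
  by left; move: e; rewrite perm_cons => /perm_small_eq -/(_ isT) [].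
right; move: e; rewrite (perm_sym _ [:: x'; y']) -(perm_rot 1) /= perm_cons.
by move/perm_small_eq => /(_ isT) [].
Qed.

Lemma ciso_mkprod A B D : ciso A (cprod B D) -> exists mk : B -> D -> A,
  [/\ forall x y, perm_eq (atoms (mk x y)) (atoms x ++ atoms y),
      forall a, exists x y, mk x y = a &
      forall x y x' y', mk x y = mk x' y' -> x = x' /\ y = y'].
Proof.
case=> f [g fK gK] fa; exists (fun x y => g (x, y)); split.
- by move=> x y; rewrite perm_sym; apply: perm_trans (fa _); rewrite gK.
- by move=> a; exists (f a).1, (f a).2; rewrite -surjective_pairing fK.
- by move=> x y x' y' /(can_inj gK)[].
Qed.

(** An element of [E] is an atom with an arbitrary finite multiset over [Q], the empty multiset
    being [inl]; [add] inserts one element. Two insertions of different elements agree only over a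
    common part [z], which is the counterpart of [teq_comm]. *)
Lemma ciso_add X Q (E := csum (catom L) X) : ciso X (cprod (catom L) (cset_geq 1 Q)) ->
  exists add : E -> Q -> X,
  [/\ forall x : X, 0 < size (atoms x),
      forall y q, perm_eq (atoms (add y q)) (@atoms L E y ++ atoms q),
      forall x, exists y q, add y q = x,
      forall y q y' q', add y q = add y' q' ->
        (y = y' /\ q = q') \/ exists z, y = inr (add z q') /\ y' = inr (add z q) &
      forall z q q', add (inr (add z q)) q' = add (inr (add z q')) q].
Proof.
case=> f [g fK gK] fa.
have pf (q : Q) r : 1 <= size (seq_mset (q :: r) : {mset Q}%mset).
  by rewrite Existence.size_canon.
pose mk l q r : X := g (l, exist (fun M : {mset Q}%mset =>
  1 <= size M) (seq_mset (q :: r)) (pf q r)).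
pose rep (y : E) : L * seq Q :=
  match y with inl l => (l, [::]) | inr x => ((f x).1, enum_mset (val (f x).2)) end.
have rep1 l q r : (rep (inr (mk l q r))).1 = l by rewrite /= gK.
have rep2 l q r : perm_eq (rep (inr (mk l q r))).2 (q :: r).
  by rewrite /= gK perm_eq_seq_mset.
have rep_inj y y' : (rep y).1 = (rep y').1 -> perm_eq (rep y).2 (rep y').2 -> y = y'.
  have sz x : 0 < size (rep (inr x)).2 by apply: (valP (f x).2).
  case: y y' => [l|x] [l'|x'].
  - by move=> /= ->.
  - by move=> _ /perm_size /= e; have := sz x'; rewrite /= -e.
  - by move=> _ /perm_size /= e; have := sz x; rewrite /= e.
  move=> /= e1 e2; congr inr; rewrite -(fK x) -(fK x'); congr g.
  case: (f x) (f x') e1 e2 => [l M] [l' M'] /= -> /eq_seq_msetP.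
  by rewrite !seq_mset_id => /val_inj ->.
have rep_at y : perm_eq (@atoms L E y) ((rep y).1 :: flatten [seq atoms q | q <- (rep y).2]).
  by case: y => [l //|x] /=; rewrite perm_sym; apply: fa.
pose add y q := mk (rep y).1 q (rep y).2.
have addP y q y' q' : add y q = add y' q' ->
  (rep y).1 = (rep y').1 /\ perm_eq (q :: (rep y).2) (q' :: (rep y').2).
  move=> e; split; first by have := rep1 (rep y).1 q (rep y).2; rewrite -/(add y q) e rep1.
  have := rep2 (rep y').1 q' (rep y').2; rewrite -/(add y' q') -e; apply: perm_trans.
  by rewrite perm_sym; apply: rep2.
have addI y q y' q' : (rep y).1 = (rep y').1 -> perm_eq (q :: (rep y).2) (q' :: (rep y').2) ->
  add y q = add y' q'.
  move=> e1 e2; apply: (@inr_inj L); apply: rep_inj; first by rewrite !rep1.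
  by apply: (perm_trans (rep2 _ _ _)); apply: perm_trans e2 _; rewrite perm_sym rep2.
exists add; split.
- by move=> x; rewrite -(perm_size (fa x)).
- move=> y q; apply: perm_trans (rep_at (inr (add y q))) _.
  rewrite rep1; apply: (@perm_trans _ (((rep y).1 :: flatten [seq atoms q | q <- (rep y).2]) ++
    atoms q)).
    rewrite /= perm_cons; apply: (perm_trans (Existence.perm_flatten_map2 _ (rep2 _ _ _))).
    by rewrite /= perm_catC.
  by rewrite perm_cat2r perm_sym.
- move=> x; case e: (rep (inr x)) => [l [|q r]].
    by have := valP (f x).2; move: e; rewrite /= => -[_ ->].
  (* Removing [q] may leave the empty multiset, represented by the bare atom. *)
  pose y : E := if r is q' :: r' then inr (mk l q' r') else inl l.
  have [y1 y2] : (rep y).1 = l /\ perm_eq (rep y).2 r.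
    by rewrite /y => {y e}; case: r => [|q' r'].
  exists y, q; apply: (@inr_inj L); apply: rep_inj; first by rewrite rep1 y1 e.
  by apply: (perm_trans (rep2 _ _ _)); rewrite e /= perm_cons.
- move=> y q y' q' /addP[e1 e2]; have [eq|nq] := eqVneq q q'.
    by left; split=> //; apply: rep_inj => //; rewrite eq perm_cons in e2.
  right; have q'y : q' \in (rep y).2.
    by have := perm_mem e2 q'; rewrite !inE eqxx eq_sym (negbTE nq).
  (* The common part is what remains of [y] without [q']. *)
  pose r := rem q' (rep y).2; have e3 := perm_to_rem q'y.
  pose z : E := if r is q0 :: r0 then inr (mk (rep y).1 q0 r0) else inl (rep y).1.
  have [z1 z2] : (rep z).1 = (rep y).1 /\ perm_eq (rep z).2 r.
    by rewrite /z; case: (r) => [|q0 r0].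
  exists z; split; apply: rep_inj; rewrite ?rep1 ?z1 ?e1 //.
    by rewrite perm_sym; apply: (perm_trans (rep2 _ _ _));
      rewrite perm_sym (perm_trans e3) // perm_cons perm_sym.
  rewrite perm_sym; apply: (perm_trans (rep2 _ _ _)).
  apply: (@perm_trans _ (q :: r)); first by rewrite perm_cons.
  rewrite -(perm_cons q'); apply: perm_trans e2; apply: (@perm_trans _ (q :: q' :: r)).
    by apply/seq.permP => P /=; lia.
  by rewrite perm_cons perm_sym.
- move=> z q q'; apply: addI; first by rewrite !rep1.
  apply: (@perm_trans _ (q' :: q :: (rep z).2)); first by rewrite perm_cons rep2.
  apply: (@perm_trans _ (q :: q' :: (rep z).2)).
    by apply/seq.permP => P /=; lia.
  by rewrite perm_cons perm_sym rep2.
Qed.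

End SpecConstructors.

(** * Trees as objects of a solution *)

Section TreeClass.
Variables (L : choiceType) (X Q QC TQQ : cclass L).
Let E := csum (catom L) X.
Variables (add : E -> Q -> X) (pairQ : E -> E -> QC) (mkQ : QC -> E -> Q).
Variable pairT : QC -> QC -> TQQ.

Hypothesis add_atoms : forall y q, perm_eq (atoms (add y q)) (@atoms L E y ++ atoms q).
Hypothesis X_atoms_gt0 : forall x : X, 0 < size (atoms x).
Hypothesis add_surj : forall x, exists y q, add y q = x.
Hypothesis add_inj : forall y q y' q', add y q = add y' q' ->
  (y = y' /\ q = q') \/ exists z, y = inr (add z q') /\ y' = inr (add z q).
Hypothesis add_comm : forall z q q', add (inr (add z q)) q' = add (inr (add z q')) q.
Hypothesis pairQ_atoms : forall x y, perm_eq (atoms (pairQ x y)) (@atoms L E x ++ @atoms L E y).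
Hypothesis pairQ_surj : forall a, exists x y, pairQ x y = a.
Hypothesis pairQP : forall x y x' y',
  pairQ x y = pairQ x' y' <-> (x = x' /\ y = y') \/ (x = y' /\ y = x').
Hypothesis mkQ_atoms : forall c y, perm_eq (atoms (mkQ c y)) (atoms c ++ @atoms L E y).
Hypothesis mkQ_surj : forall a, exists c y, mkQ c y = a.
Hypothesis mkQ_inj : forall c y c' y', mkQ c y = mkQ c' y' -> c = c' /\ y = y'.
Hypothesis pairT_atoms : forall x y, perm_eq (atoms (pairT x y)) (atoms x ++ atoms y).
Hypothesis pairT_surj : forall a, exists x y, pairT x y = a.
Hypothesis pairTP : forall x y x' y',
  pairT x y = pairT x' y' <-> (x = x' /\ y = y') \/ (x = y' /\ y = x').

Fixpoint tree_obj (t : tree L) : E :=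
  match t with
  | Lf l => inl l
  | Nd t a b d =>
    inr (add (tree_obj t) (mkQ (pairQ (tree_obj a) (tree_obj b)) (tree_obj d)))
  end.

Lemma tree_obj_atoms t : perm_eq (@atoms L E (tree_obj t)) (labels t).
Proof.
elim: t => [l|t IHt a IHa b IHb d IHd] //=.
apply: perm_trans (add_atoms _ _) _; apply: perm_cat => //.
apply: perm_trans (mkQ_atoms _ _) _; rewrite catA; apply: perm_cat => //.
by apply: perm_trans (pairQ_atoms _ _) _; apply: perm_cat.
Qed.

Lemma atoms_gt0 (y : E) : 0 < size (@atoms L E y).
Proof. by case: y => //= x; apply: X_atoms_gt0. Qed.

(** The number of atoms replaces structural induction on an abstract solution: the four constituents
    of an object are nonempty, so each is smaller than the whole. *)
Lemma tree_obj_surj (y : E) : exists t, tree_obj t = y.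
Proof.
have [n] := ubnP (size (@atoms L E y)); elim: n y => // n IH [l|x]; first by exists (Lf l).
have [y [q <-]] := add_surj x; have [c [u <-]] := mkQ_surj q; have [v [w <-]] := pairQ_surj c.
rewrite ltnS => h.
have {h} : size (atoms (add y (mkQ (pairQ v w) u))) <= n by [].
rewrite (perm_size (add_atoms _ _)) size_cat (perm_size (mkQ_atoms _ _)) size_cat.
rewrite (perm_size (pairQ_atoms _ _)) size_cat => h.
have [ly lu lv lw] : [/\ size (@atoms L E y) < n, size (@atoms L E u) < n,
    size (@atoms L E v) < n & size (@atoms L E w) < n].
  move: h (atoms_gt0 y) (atoms_gt0 u) (atoms_gt0 v) (atoms_gt0 w).
  move: (size _) (size _) (size _) (size _) => i j k l; split; lia.
have [t et] := IH y ly; have [a ea] := IH v lv; have [b eb] := IH w lw; have [d ed] := IH u lu.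
by exists (Nd t a b d); rewrite /= et ea eb ed.
Qed.

Lemma teq_tree_obj t u : teq t u -> tree_obj t = tree_obj u.
Proof.
elim=> {t u} //=.
- by move=> t u v _ -> _ ->.
- by move=> t a b d; congr (inr (add _ (mkQ _ _))); apply/pairQP; right.
- by move=> *; rewrite add_comm.
- by move=> t a b d t' a' b' d' _ -> _ -> _ -> _ ->.
Qed.

(** The analogue of [cycle_front] on the side of the objects. *)
Lemma tree_obj_front t y q : tree_obj t = inr (add y q) -> exists t0 a b d,
  [/\ teq t (Nd t0 a b d), tree_obj t0 = y &
      mkQ (pairQ (tree_obj a) (tree_obj b)) (tree_obj d) = q].
Proof.
elim: t y q => // t IHt a _ b _ d _ y q /= [/add_inj[[<- <-]|[z [ez ->]]]].
  by exists t, a, b, d.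
have [t0 [a0 [b0 [d0 [tt e0 eq]]]]] := IHt _ _ ez.
exists (Nd t0 a b d), a0, b0, d0; rewrite /= e0; split=> //.
by apply: teq_trans (teq_comm _ _ _ _ _ _ _); apply: teq_cong.
Qed.

Lemma tree_obj_teq t u : tree_obj t = tree_obj u -> teq t u.
Proof.
elim: t u => [l [l' [->]|]//|t IHt a IHa b IHb d IHd u].
move/esym/tree_obj_front => [t0 [a0 [b0 [d0 [tu /esym/IHt et]]]]].
case/esym/mkQ_inj=> /pairQP eab /IHd ed; apply: teq_trans (teq_sym tu).
case: eab => -[/IHa ea /IHb eb]; first exact: teq_cong.
by apply: teq_trans (teq_swap _ _ _ _) _; apply: teq_cong.
Qed.

Definition vertex_obj (p : quad L) : X :=
  let: (t, a, b, d) := p in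
  add (tree_obj t) (mkQ (pairQ (tree_obj a) (tree_obj b)) (tree_obj d)).

Definition flag_obj (p : quad L) : cprod Q E :=
  let: (t, a, b, d) := p in (mkQ (pairQ (tree_obj a) (tree_obj b)) (tree_obj d), tree_obj t).

(** A cyclic arrangement of four items up to rotation and reflection is the same as its two
    unordered pairs of opposite items, taken without order. *)
Definition cycle_obj (p : quad L) : TQQ :=
  let: (t, a, b, d) := p in
  pairT (pairQ (tree_obj t) (tree_obj d)) (pairQ (tree_obj a) (tree_obj b)).

Lemma vertex_obj_inr p : inr (vertex_obj p) = tree_obj (nd p).
Proof. by case: p => [[[]]]. Qed.

Lemma vertex_objP p q : vertex_obj p = vertex_obj q <-> vertex_eq p q.
Proof.
split=> [/(congr1 (@inr L X))|/teq_tree_obj]; rewrite ?vertex_obj_inr; first exact: tree_obj_teq.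
by rewrite -!vertex_obj_inr => -[].
Qed.

Lemma vertex_obj_surj x : exists p, vertex_obj p = x.
Proof.
have [[//|t a b d] /= [e]] := tree_obj_surj (inr x).
by exists (t, a, b, d).
Qed.

Lemma vertex_obj_atoms p : perm_eq (atoms (vertex_obj p)) (labels (nd p)).
Proof. by rewrite -[atoms _]/(@atoms L E (inr (vertex_obj p))) vertex_obj_inr tree_obj_atoms. Qed.

Lemma flag_objP p q : flag_obj p = flag_obj q <-> flag_eq p q.
Proof.
case: p q => [[[t a] b] d] [[[t' a'] b'] d']; split=> [[/mkQ_inj[/pairQP ab dd] tt]|/=].
  split; [exact: tree_obj_teq|exact: tree_obj_teq|].
  by case: ab => -[/tree_obj_teq ? /tree_obj_teq ?]; [left|right].
case=> /teq_tree_obj-> /teq_tree_obj-> ab; congr (mkQ _ _, _); apply/pairQP.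
by case: ab => -[/teq_tree_obj-> /teq_tree_obj->]; [left|right].
Qed.

Lemma flag_obj_surj x : exists p, flag_obj p = x.
Proof.
case: x => q y; have [c [u <-]] := mkQ_surj q; have [v [w <-]] := pairQ_surj c.
have [t <-] := tree_obj_surj y; have [a <-] := tree_obj_surj v.
have [b <-] := tree_obj_surj w; have [d <-] := tree_obj_surj u.
by exists (t, a, b, d).
Qed.

Lemma flag_obj_atoms p : perm_eq (atoms (flag_obj p)) (labels (nd p)).
Proof.
apply: perm_trans (vertex_obj_atoms p); case: p => [[[t a] b] d] /=.
rewrite perm_sym; apply: perm_trans (add_atoms _ _) _; by rewrite perm_catC.
Qed.

Lemma cycle_objP p q : cycle_obj p = cycle_obj q <-> cycle_eq p q.
Proof.
have rotE r : cycle_obj (qrot r) = cycle_obj r.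
  case: r => [[[t a] b] d] /=; apply/pairTP; right; split=> //.
  by apply/pairQP; right.
split=> [|[k pq]]; last first.
  transitivity (cycle_obj (iter k (@qrot L) q)); last by elim: k {pq} => //= k; rewrite rotE.
  case: p (iter k _ q) pq => [[[t a] b] d] [[[t' a'] b'] d'].
  case=> /teq_tree_obj/= -> /teq_tree_obj/= -> ab; congr (pairT _ _); apply/pairQP.
  by case: ab => -[/teq_tree_obj/= -> /teq_tree_obj/= ->]; [left|right].
case: p q => [[[t a] b] d] [[[t' a'] b'] d'] /= /pairTP.
case=> -[/pairQP td /pairQP ab].
  have ab' : teq a a' /\ teq b b' \/ teq a b' /\ teq b a'.
    by case: ab => -[/tree_obj_teq ? /tree_obj_teq ?]; [left|right].
  case: td => -[/tree_obj_teq tt /tree_obj_teq dd]; first by exists 0; split.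
  (* A half turn exchanges the corners within both opposite pairs. *)
  by exists 2; split=> //; case: ab'; [right|left].
have ab' : teq a t' /\ teq b d' \/ teq a d' /\ teq b t'.
  by case: ab => -[/tree_obj_teq ? /tree_obj_teq ?]; [left|right].
case: td => -[/tree_obj_teq tt /tree_obj_teq dd]; first by exists 1; split=> //; case: ab';
  [right|left].
by exists 3; split.
Qed.

Lemma cycle_obj_surj x : exists p, cycle_obj p = x.
Proof.
have [c [c' <-]] := pairT_surj x; have [u [v <-]] := pairQ_surj c.
have [w [z <-]] := pairQ_surj c'.
have [t <-] := tree_obj_surj u; have [d <-] := tree_obj_surj v.
have [a <-] := tree_obj_surj w; have [b <-] := tree_obj_surj z.
by exists (t, a, b, d).
Qed.

Lemma cycle_obj_atoms p : perm_eq (atoms (cycle_obj p)) (labels (nd p)).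
Proof.
case: p => [[[t a] b] d] /=; apply: perm_trans (pairT_atoms _ _) _.
apply: perm_trans (perm_cat (pairQ_atoms _ _) (pairQ_atoms _ _)) _.
apply: perm_trans (perm_cat (perm_cat (tree_obj_atoms _) (tree_obj_atoms _))
                            (perm_cat (tree_obj_atoms _) (tree_obj_atoms _))) _.
by apply/seq.permP => x; rewrite !count_cat; lia.
Qed.

End TreeClass.

(** * Counting in sums and in isomorphic classes *)

Section HasCard.
Variables (K K' : choiceType).

Lemma has_card_ext (P P' : pred K) k : P =1 P' -> has_card P k -> has_card P' k.
Proof. by move=> PP' [s sP sk]; exists s => // x; rewrite sP PP'. Qed.

Lemma has_card_inj (P : pred K) i j : has_card P i -> has_card P j -> i = j.
Proof.
case=> s sP <- [s' s'P <-]; congr (#|` _|%fset).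
by apply/fsetP => x; rewrite sP s'P.
Qed.

Lemma has_card_fin (P : pred K) (s : seq K) : (forall x, P x -> x \in s) ->
  exists k, has_card P k.
Proof.
move=> Ps; exists #|` [fset x in [seq x <- s | P x]]|%fset.
exists [fset x in [seq x <- s | P x]]%fset => // x; rewrite inE mem_filter.
by apply/andP/idP => [[]//|Px]; split=> //; apply: Ps.
Qed.

Lemma has_card_bijective (P : pred K) (P' : pred K') (f : K -> K') k :
  bijective f -> (forall x, P' (f x) = P x) -> has_card P k -> has_card P' k.
Proof.
case=> g fK gK fP [s sP <-]; exists [fset f x | x in s]%fset => [y|].
  apply/imfsetP/idP => [[x xs ->]|Py]; first by rewrite fP -sP.
  by exists (g y); rewrite ?gK //= sP -fP gK.
by rewrite card_imfset //; apply: can_inj fK.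
Qed.

End HasCard.
(** Finiteness of the summands belongs to the conclusion; it supplies the counts of classes that are
    not matched with graphs directly. *)
Lemma has_card_sum (K K' : choiceType) (P : pred (K + K')%type) k : has_card P k ->
  exists i j, [/\ has_card (P \o inl) i, has_card (P \o inr) j & k = i + j].
Proof.
case=> s sP <-.
pose s1 := pmap (fun x => if x is inl a then Some a else None) (enum_fset s).
pose s2 := pmap (fun x => if x is inr b then Some b else None) (enum_fset s).
have [i ci] : exists i, has_card (P \o inl) i.
  apply: (@has_card_fin _ _ s1) => a /=; rewrite -sP => aS.
  by rewrite mem_pmap; apply/mapP; exists (inl a).
have [j cj] : exists j, has_card (P \o inr) j.
  apply: (@has_card_fin _ _ s2) => b /=; rewrite -sP => bS.
  by rewrite mem_pmap; apply/mapP; exists (inr b).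
exists i, j; split=> //; case: ci cj => [u uP <-] [v vP <-].
have uI : injective (@inl K K') by move=> ? ? [].
have vI : injective (@inr K K') by move=> ? ? [].
have cu : #|` [fset @inl K K' x | x in u]|%fset = #|` u|%fset by rewrite card_imfset.
have cv : #|` [fset @inr K K' x | x in v]|%fset = #|` v|%fset by rewrite card_imfset.
rewrite -cu -cv -cardfsUI.
have -> : ([fset @inl K K' x | x in u] `&` [fset @inr K K' x | x in v] = fset0)%fset.
  apply/fsetP => x; rewrite !inE; apply/negP => /andP[/imfsetP[a _ ->] /imfsetP[b _]//].
rewrite cardfs0 addn0; congr (#|` _|%fset); apply/fsetP => x; rewrite sP in_fsetU.
apply/idP/orP => [|[]/imfsetP[y /= yu ->]]; last 2 first.
- by have := uP y; rewrite yu.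
- by have := vP y; rewrite yu.
case: x => [a|b] Px; [left|right]; apply/imfsetP; [exists a|exists b] => //=.
  by rewrite uP.
by rewrite vP.
Qed.

Section Isomorphisms.
Variable L : choiceType.
Implicit Types A B D : cclass L.

Lemma ciso_set_split A : ciso (cset_geq 1 A) (csum A (cset_geq 2 A)).
Proof.
apply: Existence.ciso_sym.
have p1 (a : A) : 0 < size (seq_mset [:: a] : {mset A}%mset) by rewrite Existence.size_canon.
have p2 (M : cset_geq 2 A) : 0 < size (val M : {mset A}%mset) by apply: ltnW (valP M).
pose f (x : csum A (cset_geq 2 A)) : cset_geq 1 A := match x with
  | inl a => exist (fun M : {mset A}%mset => 0 < size M) (seq_mset [:: a]) (p1 a)
  | inr M => exist (fun M : {mset A}%mset => 0 < size M) (val M) (p2 M) end.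
exists f; last first.
  by case=> [a|M] //=; apply: perm_trans (flatten_seq_mset _) _; rewrite /= cats0.
apply: Existence.bij_inj_surj => [[a|M] [b|N] /(congr1 val) /= |[M M1]].
- by move/eq_seq_msetP/(perm_mem)/(_ a); rewrite !inE eqxx => /esym/eqP->.
- by move=> e; have := valP N; rewrite /= -e Existence.size_canon.
- by move=> e; have := valP M; rewrite /= e Existence.size_canon.
- by move/val_inj->.
have [M2|M2] := leqP 2 (size (M : {mset A}%mset)).
  by exists (inr (exist (fun M : {mset A}%mset => 1 < size M) M M2)); apply/val_inj.
have [a ea] : exists a, enum_mset (M : {mset A}%mset) = [:: a].
  by have := M1; have := M2; case: (enum_mset _) => [|a []] // _ _; exists a.
by exists (inl a); apply/val_inj; rewrite /= -ea seq_mset_id.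
Qed.

Lemma ciso_prod_sum A B D : ciso (cprod A (csum B D)) (csum (cprod A B) (cprod A D)).
Proof.
exists (fun x : cprod A (csum B D) => match x with
  | (a, inl b) => inl (a, b) | (a, inr d) => inr (a, d) end : csum (cprod A B) (cprod A D)).
  exists (fun y : csum (cprod A B) (cprod A D) => match y with
    | inl (a, b) => (a, inl b) | inr (a, d) => (a, inr d) end : cprod A (csum B D)).
    by case=> a [].
  by case=> [[]|[]].
by case=> a [].
Qed.

Variable m : seq L.

Definition class_count A k := has_card (fun a : A => perm_eq (atoms a) m) k.

Lemma class_count_iso A B k : ciso A B -> class_count A k -> class_count B k.
Proof.
case=> f fb fa; apply: has_card_bijective fb _ => a.
by rewrite (permPl (fa a)).
Qed.

End Isomorphisms.

(** * Counting *)

Section Count.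
Variables (L : choiceType) (C : cactus_spec L) (n : nat) (col : 'I_n -> L).
Notation cnt := (class_count (map col (enum 'I_n))).

Lemma spec_count : exists q s qq d qs : nat,
  [/\ cnt (T_Q C) q, cnt (T_S C) s, cnt (T_QQ C) qq, cnt (T_QtoQ C) d & cnt (T_QS C) qs] /\
  (Posz #|orbit (@pg_action 'I_n) (col_stab col) @: cactus_graphs 'I_n| =
     Posz q + Posz s + Posz qq - Posz d - Posz qs)%R.
Proof.
have [pairQ [pQa pQs pQP]] := ciso_pair (Q_C_def C).
have [mkQ [mQa mQs mQi]] := ciso_mkprod (Q_X_def C).
have [pairT [pTa pTs pTP]] := ciso_pair (T_QQ_def C).
have [add [Xa aa as_ ai ac]] := ciso_add (S_X_def C).
have cX : cnt (S_X C) #|orbit (@pg_action 'I_n) (col_stab col) @: cactus_vertices 'I_n|.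
  apply: (@orbit_count _ _ col _ (@atoms L (S_X C)) _ (@vertex_graph 'I_n)
           (vertex_obj add pairQ mkQ) vertex_eq).
  - by move=> M M' f p q; rewrite /vertex_eq !nd_qmap; apply: teq_tmap.
  - by move=> M M' f p q; apply: vertex_eq_lift.
  - by move=> p q pq fp; apply: perm_trans fp; rewrite perm_sym; apply: perm_labels.
  - by move=> p q; apply: vertex_graph_eqP.
  - exact: vertex_graph_qmap.
  - exact: vertex_graph_full.
  - exact: vertex_graph_surj.
  - exact: vertex_objP.
  - exact: vertex_obj_surj.
  - exact: vertex_obj_atoms.
have cE : cnt (cprod (Q_X C) (csum (catom L) (S_X C)))
     #|orbit (@pg_action 'I_n) (col_stab col) @: cactus_flags 'I_n|.
  apply: (@orbit_count _ _ col _ (@atoms L (cprod (Q_X C) (csum (catom L) (S_X C)))) _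
     (@flag_graph 'I_n) (flag_obj add pairQ mkQ) flag_eq).
  - move=> M M' f [[[t a] b] d] [[[t' a'] b'] d'] [tt dd ab] /=; split; try exact: teq_tmap.
    by case: ab => -[? ?]; [left|right]; split; apply: teq_tmap.
  - by move=> M M' f p q; apply: flag_eq_lift.
  - by move=> p q pq fp; apply: perm_trans fp; rewrite perm_sym; apply/perm_labels/flag_teq.
  - by move=> p q; apply: flag_graph_eqP.
  - exact: flag_graph_qmap.
  - exact: flag_graph_full.
  - exact: flag_graph_surj.
  - exact: flag_objP.
  - exact: flag_obj_surj.
  - exact: flag_obj_atoms.
have cQQ : cnt (T_QQ C) #|orbit (@pg_action 'I_n) (col_stab col) @: cactus_cycles 'I_n|.
  apply: (@orbit_count _ _ col _ (@atoms L (T_QQ C)) _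
     (@cycle_graph 'I_n) (cycle_obj add pairQ mkQ pairT) cycle_eq).
  - move=> M M' f p q [k pq]; exists k.
    have -> : iter k (@qrot M') (qmap f q) = qmap f (iter k (@qrot M) q).
      by elim: k {pq} => //= k ->; rewrite qmap_rot.
    case: p (iter k _ q) pq => [[[t a] b] d] [[[t' a'] b'] d'] [tt dd ab] /=; split;
      try exact: teq_tmap.
    by case: ab => -[? ?]; [left|right]; split; apply: teq_tmap.
  - by move=> M M' f p q; apply: cycle_eq_lift.
  - by move=> p q pq fp; apply: perm_trans fp; rewrite perm_sym; apply: perm_labels_cycle.
  - by move=> p q; apply: cycle_graph_eqP.
  - exact: cycle_graph_qmap.
  - exact: cycle_graph_full.
  - exact: cycle_graph_surj.
  - exact: cycle_objP.
  - exact: cycle_obj_surj.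
  - exact: cycle_obj_atoms.
have dis : #|orbit (@pg_action 'I_n) (col_stab col) @: cactus_vertices 'I_n| +
    #|orbit (@pg_action 'I_n) (col_stab col) @: cactus_cycles 'I_n| =
    #|orbit (@pg_action 'I_n) (col_stab col) @: cactus_flags 'I_n| +
    #|orbit (@pg_action 'I_n) (col_stab col) @: cactus_graphs 'I_n|.
  exact: (dissymmetry (col_stab_group col)).
have [u [s [cu cs eX]]] : exists u s, [/\ cnt (cprod (catom L) (Q_X C)) u, cnt (T_S C) s &
    #|orbit (@pg_action 'I_n) (col_stab col) @: cactus_vertices 'I_n| = u + s].
  have i1 : ciso (S_X C) (csum (cprod (catom L) (Q_X C)) (cprod (catom L) (cset_geq 2 (Q_X C)))).
    apply: Existence.ciso_trans (S_X_def C) _.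
    apply: Existence.ciso_trans (ciso_prod_sum _ _ _).
    by apply: Existence.ciso_prod (Existence.ciso_refl _) (ciso_set_split _).
  have [u [s [cu cs e]]] := has_card_sum (class_count_iso i1 cX).
  exists u, s; split=> //; apply: class_count_iso cs; apply: Existence.ciso_sym.
  apply: Existence.ciso_trans (T_S_def C) _.
  by apply: Existence.ciso_prod (Existence.ciso_refl _) (S_C_def C).
(* The summand [Q_X * Z] is, up to the order of factors, the one already counted by [u], so both
   cancel at the end. *)
have [u' [qs [cu' cqs eE]]] := has_card_sum (class_count_iso (ciso_prod_sum _ _ _) cE).
have uu : u' = u.
  apply: has_card_inj cu; exact: class_count_iso (Existence.ciso_prodC _ _) cu'.
(* The value of [q] cancels, so only finiteness is at stake: at most two ordered pairs lie over each
   element of [T_QQ]. *)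
have [q cq] : exists q, cnt (cprod (Q_C C) (Q_C C)) q.
  have [z zP _] := cQQ.
  have [l lP] : exists l : seq (Q_C C * Q_C C)%type,
      forall x y, pairT x y \in enum_fset z -> (x, y) \in l.
    elim: (enum_fset z) => [|a r [l lP]]; first by exists [::].
    have [x [y <-]] := pTs a; exists [:: (x, y), (y, x) & l] => x' y'.
    rewrite !inE => /orP[/eqP/pTP[[-> ->]|[-> ->]]|/lP->]; by rewrite ?eqxx ?orbT.
  apply: (@has_card_fin _ _ l) => -[x y] xy; apply: lP.
  suff : pairT x y \in z by [].
  by rewrite zP; apply: perm_trans (pTa x y) xy.
exists q, s, #|orbit (@pg_action 'I_n) (col_stab col) @: cactus_cycles 'I_n|, q, qs.
split.
  split=> //.
  - exact: class_count_iso (Existence.ciso_sym (T_Q_def C)) cq.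
  - exact: class_count_iso (Existence.ciso_sym (T_QtoQ_def C)) cq.
  - exact: class_count_iso (Existence.ciso_sym (T_QS_def C)) cqs.
move: dis; rewrite eX eE uu; move: #|_| #|_| => x y; lia.
Qed.

End Count.

(** * The two settings as colourings *)

Lemma card_imset_rel (A B D : finType) (S : {set A}) (f : A -> B) (g : A -> D) :
  {in S &, forall x y, f x = f y <-> g x = g y} -> #|f @: S| = #|g @: S|.
Proof.
move=> fg; pose P := [set (f x, g x) | x in S].
have -> : f @: S = [set x.1 | x in P] by rewrite -imset_comp.
have -> : g @: S = [set x.2 | x in P] by rewrite -imset_comp.
transitivity #|P|; [|symmetry]; apply: card_in_imset.
  by move=> _ _ /imsetP[x xS ->] /imsetP[y yS ->] /= e; rewrite e; congr pair; apply/fg.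
by move=> _ _ /imsetP[x xS ->] /imsetP[y yS ->] /= e; rewrite e; congr pair; apply/fg.
Qed.

Lemma cacti_ord n : cacti 'I_n = four_cacti n.
Proof. by apply/setP => G; rewrite !in_set card_ord. Qed.

(** Only the identity preserves an injective colouring, so every orbit is a single graph. *)
Lemma num_labeledE n (col : 'I_n -> nat) : injective col ->
  num_labeled_four_cacti n = #|orbit (@pg_action 'I_n) (col_stab col) @: cactus_graphs 'I_n|.
Proof.
move=> colI; rewrite /num_labeled_four_cacti -cacti_ord -card_graphs.
rewrite card_in_imset // => v w _ _ e.
have /imsetP[s /col_stabP sc ->] : v \in orbit (@pg_action 'I_n) (col_stab col) w by
  apply/orbit_eqP.
suff -> : s = 1%g by rewrite /= pg_act1.
by apply/permP => i; rewrite perm1; apply: colI; apply: sc.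
Qed.

(** Every permutation preserves a colouring by [unit], so two graphs are isomorphic exactly when
    they lie in one orbit; blocks and orbits are then compared as images of maps with the same
    fibres. *)
Lemma num_unlabeledE n (col : 'I_n -> unit) :
  num_unlabeled_four_cacti n = #|orbit (@pg_action 'I_n) (col_stab col) @: cactus_graphs 'I_n|.
Proof.
rewrite cactus_graphsE -imset_comp cacti_ord.
pose i G : pointed_graph 'I_n := (G, set0, set0).
have isoE G G' : graph_iso G G' = (i G' \in orbit (@pg_action 'I_n) (col_stab col) (i G)).
  apply/existsP/imsetP => [[s /eqP->]|[s _ [->]]]; last by exists s.
  exists s; first by apply/col_stabP => x; case: (col x); case: (_ x).
  by rewrite /i /= /pg_act /= /relabel !imset0.
apply: card_imset_rel => G G' GF G'F; split=> [/setP/(_ G')|/= e].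
  rewrite in_set [in RHS]in_set G'F !isoE orbit_refl => /orbit_eqP e; exact: esym e.
by apply/setP => y; rewrite in_set [in RHS]in_set !isoE /i e.
Qed.

(* The existence of the numbers q, s, qq, d, qs includes the finiteness of the
   classes in each size. *)
Theorem theorem14 :
  (forall (C : cactus_spec nat) (n : nat),
     exists q s qq d qs : nat,
       labeled_count (T_Q C) n q /\
       labeled_count (T_S C) n s /\
       labeled_count (T_QQ C) n qq /\
       labeled_count (T_QtoQ C) n d /\
       labeled_count (T_QS C) n qs /\
       (Posz (num_labeled_four_cacti n) =
          Posz q + Posz s + Posz qq - Posz d - Posz qs)%R) /\
  (forall (C : cactus_spec unit) (n : nat),
     exists q s qq d qs : nat,
       unlabeled_count (T_Q C) n q /\
       unlabeled_count (T_S C) n s /\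
       unlabeled_count (T_QQ C) n qq /\
       unlabeled_count (T_QtoQ C) n d /\
       unlabeled_count (T_QS C) n qs /\
       (Posz (num_unlabeled_four_cacti n) =
          Posz q + Posz s + Posz qq - Posz d - Posz qs)%R).
Proof.
split=> C n.
  have [q [s [qq [d [qs [[hq hs hqq hd hqs] e]]]]]] := spec_count C (fun i : 'I_n => i.+1).
  have m : [seq (i : 'I_n).+1 | i <- enum 'I_n] = iota 1 n.
    by rewrite -[1]addn0 iotaDl -val_enum_ord -map_comp.
  rewrite m in hq hs hqq hd hqs; exists q, s, qq, d, qs; do 5 split=> //.
  by rewrite (num_labeledE (col := fun i : 'I_n => i.+1)) // => i j [/val_inj].
have [q [s [qq [d [qs [[hq hs hqq hd hqs] e]]]]]] := spec_count C (fun i : 'I_n => tt).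
have U (A : cclass unit) k : class_count [seq tt | i <- enum 'I_n] A k -> unlabeled_count A n k.
  apply: has_card_ext => a.
  (* A list over [unit] is determined by its length, so comparing atoms up to order amounts to
     comparing sizes. *)
  have tts (s1 : seq unit) : s1 = nseq (size s1) tt by elim: s1 => //= -[] s1 <-.
  apply/idP/eqP => [/perm_size->|an]; first by rewrite size_map size_enum_ord.
  by rewrite (tts (atoms a)) (tts (map _ _)) an size_map size_enum_ord.
exists q, s, qq, d, qs; do 5 (split; first exact: U).
by rewrite (num_unlabeledE (fun i => tt)).
Qed.
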